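(* Let $d=d(n)$ be a sequence of positive real numbers with $\log n\ll d\ll n$, and let $\boldsymbol{d}=\boldsymbol{d}(n)\in\{0,\dots,n-1\}^n$ be a near $d$-regular realisable degree sequence. Then there are $p_*=(1-o(1))d/n$ and a coupling $(G_*,G)$ such that $G_*\sim\mathcal{G}(n,p_* )$, $G\sim\mathcal{G}(n,\boldsymbol{d})$ and $\Pr(G_*\subseteq G)=1-o(1)$.
   Context: All asymptotics are as $n\to\infty$. $a_n\ll b_n$ means $a_n=o(b_n)$. All graphs are simple graphs on $[n]=\{1,\dots,n\}$, and $\subseteq$ means containment of edge sets. For $\boldsymbol{d}=(d_1,\dots,d_n)$, $\Delta(\boldsymbol{d})=\max_j d_j$ and $\operatorname{rng}(\boldsymbol{d})=\max_j d_j-\min_j d_j$. The sequence $\boldsymbol{d}=\boldsymbol{d}(n)\in\{0,\dots,n-1\}^n$ is called near $d$-regular if $|\Delta(\boldsymbol{d})-d|\ll\min\{d,n-d\}$ and $\operatorname{rng}(\boldsymbol{d})\ll\min\{d,n-d\}$ as $n\to\infty$. $\boldsymbol{d}$ is realisable if there is a graph on $[n]$ in which each vertex $i$ has degree $d_i$. $\mathcal{G}(n,p)$ is the binomial random graph (each pair is an edge independently with probability $p$); $\mathcal{G}(n,\boldsymbol{d})$ is the uniformly random graph on $[n]$ with degree sequence $\boldsymbol{d}$. A coupling is a joint distribution, on one probability space, of random graphs with the prescribed marginal distributions. *)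

(* Defs.v *)
From mathcomp Require Import all_boot all_order all_algebra.
From mathcomp Require Import all_classical all_reals all_analysis.

Set Implicit Arguments.
Unset Strict Implicit.
Unset Printing Implicit Defensive.

Import Order.TTheory GRing.Theory Num.Theory.
Import numFieldNormedType.Exports.

Local Open Scope classical_set_scope.
Local Open Scope ring_scope.

(* A simple graph on 'I_n is given by its edge set, a set of 2-subsets. *)
Definition sgraph (n : nat) : Type :=
  {E : {set {set 'I_n}} | [forall e in E, #|e| == 2%N]}.

Definition edges (n : nat) (G : sgraph n) : {set {set 'I_n}} := val G.

Definition degree (n : nat) (G : sgraph n) (i : 'I_n) : nat :=
  #|[pred e in edges G | i \in e]|.

Definition has_degrees (n : nat) (dd : 'I_n -> nat) (G : sgraph n) : bool :=
  [forall i, degree G i == dd i].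

Definition realisable (n : nat) (dd : 'I_n -> nat) : Prop :=
  exists G : sgraph n, has_degrees dd G.

Definition maxdeg (n : nat) (dd : 'I_n -> nat) : nat := \max_(i < n) dd i.

(* The default value [maxdeg dd] does not affect the minimum when n > 0. *)
Definition mindeg (n : nat) (dd : 'I_n -> nat) : nat :=
  \big[minn/maxdeg dd]_(i < n) dd i.

Definition rng (n : nat) (dd : 'I_n -> nat) : nat := (maxdeg dd - mindeg dd)%N.

Definition near_regular (R : realType) (d : nat -> R)
    (dd : forall n : nat, 'I_n -> nat) : Prop :=
  let m := fun n : nat => Num.min (d n) (n%:R - d n) in
  ((fun n : nat => `|(maxdeg (dd n))%:R - d n| : R^o) =o_\oo (m : nat -> R^o))
  /\ ((fun n : nat => (rng (dd n))%:R : R^o) =o_\oo (m : nat -> R^o)).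

(* Random graphs live on a finite type: a law is given by its probability mass
   function, a coupling by a joint mass function on pairs of graphs. *)

Definition gnp_law (R : realType) (n : nat) (p : R) (G : sgraph n) : R :=
  \prod_(e : {set 'I_n} | #|e| == 2%N) (if e \in edges G then p else 1 - p).

Definition gnd_law (R : realType) (n : nat) (dd : 'I_n -> nat)
    (G : sgraph n) : R :=
  if has_degrees dd G then #|[pred H : sgraph n | has_degrees dd H]|%:R^-1 else 0.

Definition is_pmf (R : realType) (T : finType) (mu : T -> R) : Prop :=
  (forall x, 0 <= mu x) /\ \sum_x mu x = 1.

Definition is_coupling (R : realType) (T U : finType)
    (mu : T -> R) (nu : U -> R) (kappa : T * U -> R) : Prop :=
  [/\ is_pmf kappa,
      forall x, \sum_y kappa (x, y) = mu x
    & forall y, \sum_x kappa (x, y) = nu y].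

Definition prob (R : realType) (T : finType) (mu : T -> R) (A : pred T) : R :=
  \sum_(x | A x) mu x.

(* Main.v *)
Require Import Defs.
From mathcomp Require Import all_classical all_reals all_analysis.
From mathcomp Require Import all_boot all_order all_algebra.
From mathcomp Require Import ring lra.

(** Expose the edges of G, uniform with degree sequence dd, in random order:
    at time s in [0, 1] the exposed set S keeps every edge of G independently
    with probability s.  Given S, the graph G is uniform among the graphs with
    degrees dd that contain S, so a pair e outside S gets exposed at rate
    P(e in G | S) / (1 - s).  Suppose that P(e in G | S) >= (1 - o(1)) (1 - s) d / n
    for all e outside S, at all times up to 1 - a.  Then a process U in which
    every pair arrives at the slightly smaller constant rate (1 - o(1)) d / n can
    be run so that it stays below S: whenever U gains a pair, S gains it too or
    has it already.  At time 1 - a the set U is a binomial random graph of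
    density (1 - o(1)) (1 - a) d / n, and it is contained in G.

    The lower bound on P(e in G | S), for e = uv, comes from a switching
    (switching_lower).  In a graph without uv take unexposed edges ux and vy and
    replace them by uv and xy.  The reverse move starts from one of the
    (1 - s) d n oriented unexposed edges xy, while the number of forward moves
    is about ((1 - s) d)^2, provided that
    - the residual degrees dd w - deg_S w are all close to (1 - s) d; this is a
      Chernoff bound (thin_tail) and uses that d is much larger than log n;
    - few pairs (x, y) are spoiled by an edge xy already present, that is, G has
      o(d^2) walks of length three from u to v; graphs violating this are
      called crowded.
    Crowded graphs are very rare.  The opposite switching (switching_upper) shows
    that a fixed set of h = O(d^2) edges lies in G with probability at most
    (O(d / n))^h; since d is much smaller than n and log n is at most d, this beats
    the number n^(2 D) 2^(D^2) of ways to choose two neighbourhoods, D being the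
    maximal degree, and a set of pairs between them (crowded_proportion).  By
    Markov's inequality G is then unlikely to be crowded also conditionally on S.

    Time is cut into n^5 steps, so short that gaining two edges in one step is
    negligible (embeds_chain).  Couplings are joint mass functions whose
    marginals lie below the two laws: whatever goes wrong merely loses mass, the
    losses of all steps add up, and at the end the defects of the two marginals
    are filled in by a product (subcoupling_extend).  This gives, for every fixed
    a and all large n, a coupling that fails with probability at most a
    (finite_embedding); letting a tend to 0 slowly with n gives the theorem. *)

Set Implicit Arguments.
Unset Strict Implicit.
Unset Printing Implicit Defensive.

Import Order.TTheory GRing.Theory Num.Theory.
Import numFieldNormedType.Exports.

Local Open Scope ring_scope.

(** * Couplings that may lose mass *)

(** The lost mass stands for the event that a construction has failed; no
    failure state is carried along. *)
Definition subcoupling (R : realFieldType) (A B : finType)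
    (mu : A -> R) (nu : B -> R) (k : A -> B -> R) : Prop :=
  [/\ forall a b, 0 <= k a b,
      forall a, \sum_b k a b <= mu a
    & forall b, \sum_a k a b <= nu b].

Definition mass (R : realFieldType) (A B : finType) (k : A -> B -> R) : R :=
  \sum_a \sum_b k a b.

(** Two chains, coupled so far by k, make one step each; from the states a
    and b their transitions are coupled by C a b.  Inequalities suffice
    throughout, so C a b may be 0 at states where the step is given up. *)
Lemma subcoupling_comp (R : realFieldType) (A B A' B' : finType)
    (mu : A -> R) (nu : B -> R) (k : A -> B -> R)
    (K1 : A -> A' -> R) (K2 : B -> B' -> R) (C : A -> B -> A' -> B' -> R)
    (mu' : A' -> R) (nu' : B' -> R) :
    (forall a a', 0 <= K1 a a') -> (forall b b', 0 <= K2 b b') ->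
    subcoupling mu nu k ->
    (forall a b, k a b != 0 -> subcoupling (K1 a) (K2 b) (C a b)) ->
    (forall a', \sum_a mu a * K1 a a' <= mu' a') ->
    (forall b', \sum_b nu b * K2 b b' <= nu' b') ->
  subcoupling mu' nu' (fun a' b' => \sum_a \sum_b k a b * C a b a' b').
Proof.
move=> K1ge K2ge [k_ge k1 k2] HC Hmu Hnu; split.
- move=> a' b'; apply: sumr_ge0 => a _; apply: sumr_ge0 => b _.
  have [->|kab] := eqVneq (k a b) 0; first by rewrite mul0r.
  by have [Cge _ _] := HC _ _ kab; rewrite mulr_ge0.
- move=> a'; apply: le_trans (Hmu a').
  rewrite exchange_big /=; apply: ler_sum => a _.
  rewrite exchange_big /=.
  apply: le_trans (_ : \sum_b k a b * K1 a a' <= _); last first.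
    by rewrite -mulr_suml ler_wpM2r.
  apply: ler_sum => b _; rewrite -mulr_sumr.
  have [->|kab] := eqVneq (k a b) 0; first by rewrite !mul0r.
  by have [_ C1 _] := HC _ _ kab; rewrite ler_wpM2l.
- move=> b'; apply: le_trans (Hnu b').
  rewrite exchange_big /=.
  under eq_bigr => a _ do rewrite exchange_big /=.
  rewrite exchange_big /=; apply: ler_sum => b _.
  apply: le_trans (_ : \sum_a k a b * K2 b b' <= _); last first.
    by rewrite -mulr_suml ler_wpM2r.
  apply: ler_sum => a _; rewrite -mulr_sumr.
  have [->|kab] := eqVneq (k a b) 0; first by rewrite !mul0r.
  by have [_ _ C2] := HC _ _ kab; rewrite ler_wpM2l.
Qed.

Lemma mass_comp (R : realFieldType) (A B A' B' : finType) (k : A -> B -> R)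
    (C : A -> B -> A' -> B' -> R) :
  mass (fun a' b' => \sum_a \sum_b k a b * C a b a' b')
  = \sum_a \sum_b k a b * mass (C a b).
Proof.
rewrite /mass; under eq_bigr => a' _ do rewrite exchange_big /=.
rewrite exchange_big /=; apply: eq_bigr => a _.
under eq_bigr => a' _ do rewrite exchange_big /=.
rewrite exchange_big /=; apply: eq_bigr => b _; rewrite mulr_sumr.
by apply: eq_bigr => a' _; rewrite mulr_sumr.
Qed.

(** Both marginals of k miss the same total mass D, so the product of the two
    defects divided by D repairs them simultaneously.  If D = 0 then both
    defects vanish, and the division by 0 is harmless. *)
Lemma subcoupling_extend (R : realFieldType) (A B : finType)
    (mu : A -> R) (nu : B -> R) (k : A -> B -> R) :
    \sum_a mu a = 1 -> \sum_b nu b = 1 -> subcoupling mu nu k ->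
  exists kappa : A * B -> R,
    [/\ forall x, k x.1 x.2 <= kappa x,
        forall a, \sum_b kappa (a, b) = mu a
      & forall b, \sum_a kappa (a, b) = nu b].
Proof.
move=> mu1 nu1 [k_ge kmu knu].
pose f a := mu a - \sum_b k a b; pose g b := nu b - \sum_a k a b.
have f_ge a : 0 <= f a by rewrite subr_ge0.
have g_ge b : 0 <= g b by rewrite subr_ge0.
pose D := 1 - mass k.
have fD : \sum_a f a = D by rewrite sumrB mu1.
have gD : \sum_b g b = D by rewrite sumrB nu1 exchange_big.
have D_ge : 0 <= D by rewrite -fD sumr_ge0.
have f0 a : D = 0 -> f a = 0.
  by move=> D0; move: fD; rewrite D0 => /psumr_eq0P -> .
have g0 b : D = 0 -> g b = 0.
  by move=> D0; move: gD; rewrite D0 => /psumr_eq0P -> .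
exists (fun x => k x.1 x.2 + f x.1 * g x.2 / D); split.
- by move=> x; rewrite lerDl divr_ge0 ?mulr_ge0.
- move=> a /=; rewrite big_split /= -mulr_suml -mulr_sumr gD.
  have [D0|D0] := eqVneq D 0; last by rewrite mulfK // /f; ring.
  by rewrite f0 // !mul0r addr0; have := f0 a D0; rewrite /f; lra.
- move=> b /=; rewrite big_split /= -mulr_suml -mulr_suml fD.
  have [D0|D0] := eqVneq D 0; last by rewrite [D * _]mulrC mulfK // /g; ring.
  by rewrite g0 // mulr0 !mul0r addr0; have := g0 b D0; rewrite /g; lra.
Qed.

(** * Exposing a random set element by element *)

Lemma sum_subset_prod (R : comRingType) (T : finType) (A : {set T})
    (f g : T -> R) :
  \sum_(S : {set T} | S \subset A) \prod_(i in A) (if i \in S then f i else g i)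
  = \prod_(i in A) (f i + g i).
Proof.
pose F i := if i \in A then f i else 0; pose G i := if i \in A then g i else 1.
rewrite [RHS]big_mkcond /=.
have -> : \prod_i (if i \in A then f i + g i else 1) = \prod_i (F i + G i).
  by apply: eq_bigr => i _; rewrite /F /G; case: ifP; rewrite ?add0r.
rewrite bigA_distr [LHS]big_mkcond /=; apply: eq_bigr => S _.
case: ifPn => [/subsetP SA|/subsetPn [i iS iA]].
  rewrite big_mkcond /=; apply: eq_bigr => i _; rewrite /F /G.
  by case: ifPn => iA; case: ifPn => // /SA; rewrite (negbTE iA).
by rewrite (bigD1 i) //= iS /F (negbTE iA) mul0r.
Qed.

Lemma prod_subset_const (R : comRingType) (T : finType) (S A : {set T}) (x y : R) :
  S \subset A ->
  \prod_(i in A) (if i \in S then x else y) = x ^+ #|S| * y ^+ (#|A| - #|S|).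
Proof.
move=> SA; rewrite (big_setID S) /= (setIidPr SA); congr (_ * _).
  rewrite (eq_bigr (fun=> x)) ?prodr_const // => i -> //.
rewrite (eq_bigr (fun=> y)); first by rewrite prodr_const cardsDS.
by move=> i; rewrite inE => /andP[/negbTE ->].
Qed.

Lemma sum_subset_binom (R : comRingType) (T : finType) (A : {set T}) (x y : R) :
  \sum_(S : {set T} | S \subset A) x ^+ #|S| * y ^+ (#|A| - #|S|)
  = (x + y) ^+ #|A|.
Proof.
rewrite -prodr_const -sum_subset_prod; apply: eq_bigr => S SA.
by rewrite prod_subset_const.
Qed.

Definition supersets (T : finType) (GG : {set {set T}}) (S : {set T}) :
  {set {set T}} := [set G in GG | S \subset G].

(** The law of the set obtained by choosing G uniformly in GG and keeping each
    of its elements independently with probability s.  As all members of GG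
    are to have m elements, the weight of S given G depends on the size of S
    only.  For GG = [set E] this is the product measure on the subsets of E. *)
Definition thin (R : realFieldType) (T : finType) (GG : {set {set T}})
    (m : nat) (s : R) (S : {set T}) : R :=
  s ^+ #|S| * (1 - s) ^+ (m - #|S|) * (#|supersets GG S|%:R / #|GG|%:R).

(** The exposure step: given the exposed set S, the hidden G is uniform among
    the members of GG above S, and each of its remaining elements gets exposed
    with probability sg. *)
Definition thin_kernel (R : realFieldType) (T : finType) (GG : {set {set T}})
    (m : nat) (sg : R) (S S' : {set T}) : R :=
  if S \subset S' then
    sg ^+ (#|S'| - #|S|) * (1 - sg) ^+ (m - #|S'|)
    * (#|supersets GG S'|%:R / #|supersets GG S|%:R)
  else 0.

Lemma supersetsS (T : finType) (GG : {set {set T}}) (S S' : {set T}) :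
  S \subset S' -> supersets GG S' \subset supersets GG S.
Proof.
move=> SS'; apply/subsetP => G; rewrite !inE => /andP[-> /=].
exact: subset_trans.
Qed.

Lemma thin_ge0 (R : realFieldType) (T : finType) (GG : {set {set T}})
    (m : nat) (s : R) (S : {set T}) : 0 <= s <= 1 -> 0 <= thin GG m s S.
Proof.
by move=> /andP[s0 s1]; rewrite !mulr_ge0 ?exprn_ge0 ?invr_ge0 ?subr_ge0.
Qed.

Lemma thin_kernel_ge0 (R : realFieldType) (T : finType) (GG : {set {set T}})
    (m : nat) (sg : R) (S S' : {set T}) :
  0 <= sg <= 1 -> 0 <= thin_kernel GG m sg S S'.
Proof.
move=> /andP[s0 s1]; rewrite /thin_kernel; case: ifP => // _.
by rewrite !mulr_ge0 ?exprn_ge0 ?invr_ge0 ?subr_ge0.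
Qed.

(** The thinned law in the order of its construction: first G, then S. *)
Lemma thin_sum (R : realFieldType) (T : finType) (GG : {set {set T}})
    (m : nat) (s : R) (h : {set T} -> R) :
    (forall G, G \in GG -> #|G| = m) ->
  \sum_S thin GG m s S * h S
  = (\sum_(G in GG) \sum_(S : {set T} | S \subset G)
       s ^+ #|S| * (1 - s) ^+ (#|G| - #|S|) * h S) / #|GG|%:R.
Proof.
move=> szG; rewrite mulr_suml.
under [RHS]eq_bigr => G _ do rewrite big_mkcond /= mulr_suml.
rewrite exchange_big /=; apply: eq_bigr => S _.
rewrite /thin.
have -> : #|supersets GG S|%:R = \sum_(G in GG) (S \subset G)%:R :> R.
  rewrite -sum1_card natr_sum big_mkcond [RHS]big_mkcond /=.
  by apply: eq_bigr => G _; rewrite inE; case: (G \in GG); case: (_ \subset _).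
rewrite !mulr_suml mulr_sumr mulr_suml; apply: eq_bigr => G GGG.
by rewrite (szG G GGG); case: (_ \subset _) => /=; ring.
Qed.

Lemma thin_sum1 (R : realFieldType) (T : finType) (GG : {set {set T}})
    (m : nat) (s : R) :
    (forall G, G \in GG -> #|G| = m) -> (0 < #|GG|)%N ->
  \sum_S thin GG m s S = 1.
Proof.
move=> szG GG0; under eq_bigr => S _ do rewrite -[thin _ _ _ _]mulr1.
rewrite (thin_sum _ (fun=> 1)) //.
rewrite (eq_bigr (fun=> 1)); first by rewrite sumr_const divff // pnatr_eq0 -lt0n.
move=> G GGG; under eq_bigr => S _ do rewrite mulr1.
by rewrite sum_subset_binom addrC subrK expr1n.
Qed.

(** Keeping with probability s and then exposing the rest with probability sg
    amounts to keeping with probability s', where 1 - s' = (1 - s) (1 - sg).  The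
    number of sets of GG above S cancels, and the sum over S is binomial. *)
Lemma thin_kernel_step (R : realFieldType) (T : finType) (GG : {set {set T}})
    (m : nat) (s sg s' : R) (S' : {set T}) :
    (forall G, G \in GG -> #|G| = m) ->
    1 - s' = (1 - s) * (1 - sg) ->
  \sum_S thin GG m s S * thin_kernel GG m sg S S' = thin GG m s' S'.
Proof.
move=> szG ss'.
have [c0|c0] := eqVneq #|supersets GG S'| 0%N.
  rewrite /thin c0 !(mul0r, mulr0) big1 // => S _.
  by rewrite /thin_kernel c0; case: ifP; rewrite !(mul0r, mulr0).
have [G GS] : exists G, G \in supersets GG S'.
  by apply/card_gt0P; rewrite lt0n.
have Sm : (#|S'| <= m)%N.
  by move: GS; rewrite inE => /andP[/szG <- /subset_leq_card].
have -> : thin GG m s' S' = \sum_(S : {set T} | S \subset S')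
    s ^+ #|S| * ((1 - s) * sg) ^+ (#|S'| - #|S|)
    * ((1 - s') ^+ (m - #|S'|) * (#|supersets GG S'|%:R / #|GG|%:R)).
  rewrite -mulr_suml sum_subset_binom /thin -mulrA; congr (_ ^+ _ * _).
  by apply: oppr_inj; rewrite -[LHS](addKr 1) ss'; ring.
rewrite [RHS]big_mkcond /=; apply: eq_bigr => S _.
rewrite /thin_kernel; case: ifPn => SS'; last by rewrite mulr0.
have cS : #|supersets GG S|%:R != 0 :> R.
  rewrite pnatr_eq0 -lt0n; apply: leq_trans (subset_leq_card (supersetsS GG SS')).
  by rewrite lt0n.
have GG0 : #|GG|%:R != 0 :> R.
  rewrite pnatr_eq0 -lt0n; apply/card_gt0P; exists G.
  by move: GS; rewrite inE => /andP[].
rewrite /thin.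
have -> : (m - #|S| = (m - #|S'|) + (#|S'| - #|S|))%N.
  by rewrite addnBA ?subset_leq_card // subnK.
rewrite ss' exprD !exprMn; field.
by rewrite cS GG0.
Qed.

(** Both sides count the pairs of a member G above S and an element of G
    outside S. *)
Lemma sum_supersets_ext (T : finType) (GG : {set {set T}}) (m : nat)
    (S : {set T}) :
    (forall G, G \in GG -> #|G| = m) ->
  (\sum_(e | e \notin S) #|supersets GG (e |: S)| = (m - #|S|) * #|supersets GG S|)%N.
Proof.
move=> szG; under eq_bigr => e _ do rewrite -sum1_card big_mkcond /=.
rewrite exchange_big /= -[#|supersets GG S|]sum1_card big_distrr /=.
rewrite [RHS]big_mkcond /=; apply: eq_bigr => G _.
case: ifPn => [|GS].
  rewrite inE => /andP[GG0 SG]; rewrite muln1 -(szG G GG0) -cardsDS // -sum1_card.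
  rewrite big_mkcond [RHS]big_mkcond /=; apply: eq_bigr => e _.
  by rewrite !inE subUset sub1set SG GG0 andbT; case: (e \in S).
rewrite big1 // => e eS; rewrite inE subUset.
by case: ifP => // /and3P[GG0 _ SG]; move: GS; rewrite inE GG0 SG.
Qed.

Lemma bernoulli_le (R : realFieldType) (x : R) (k : nat) :
  0 <= x <= 1 -> 1 - k%:R * x <= (1 - x) ^+ k.
Proof.
move=> /andP[x0 x1]; elim: k => [|k IH]; first by rewrite mul0r subr0 expr0.
rewrite exprS; apply: le_trans (_ : (1 - x) * (1 - k%:R * x) <= _); last first.
  by rewrite ler_wpM2l ?subr_ge0.
have : 0 <= k%:R * x ^+ 2 by rewrite mulr_ge0 ?sqr_ge0.
by rewrite -natr1; nra.
Qed.

(** The middle term is the probability that a binomial variable with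
    parameters k and x is at most 1. *)
Lemma binomial_le1 (R : realFieldType) (x : R) (k : nat) :
  0 <= x <= 1 ->
  1 - (k%:R * x) ^+ 2 <= (1 - x) ^+ k + k%:R * (x * (1 - x) ^+ k.-1) <= 1.
Proof.
move=> /andP[x0 x1]; case: k => [|k /=]; first by rewrite !mul0r expr0; lra.
have y0 : 0 <= (1 - x) ^+ k by rewrite exprn_ge0 ?subr_ge0.
have -> : (1 - x) ^+ k.+1 + k.+1%:R * (x * (1 - x) ^+ k) =
          (1 - x) ^+ k * (1 + k%:R * x) by rewrite exprS -natr1; ring.
apply/andP; split.
  have := @bernoulli_le R x k; rewrite x0 x1 => /(_ isT) B.
  have kx : 0 <= k%:R * x by rewrite mulr_ge0.
  have : (1 - k%:R * x) * (1 + k%:R * x) <= (1 - x) ^+ k * (1 + k%:R * x).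
    by apply: ler_wpM2r => //; lra.
  by apply: le_trans; rewrite -natr1; nra.
elim: k {y0} => [|k IH]; first by rewrite expr0 mul0r; lra.
rewrite exprS; apply: le_trans IH; rewrite -mulrA mulrCA ler_wpM2l //.
  by rewrite exprn_ge0 ?subr_ge0.
have : 0 <= k%:R * x ^+ 2 by rewrite mulr_ge0 ?sqr_ge0.
by rewrite -natr1; nra.
Qed.

Lemma thin_kernel_stay (R : realFieldType) (T : finType) (GG : {set {set T}})
    (m : nat) (sg : R) (S : {set T}) : supersets GG S != finset.set0 ->
  thin_kernel GG m sg S S = (1 - sg) ^+ (m - #|S|).
Proof.
move=> S0; rewrite /thin_kernel subxx subnn expr0 mul1r divff ?mulr1 //.
by rewrite pnatr_eq0 cards_eq0.
Qed.

Lemma thin_kernel_ext (R : realFieldType) (T : finType) (GG : {set {set T}})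
    (m : nat) (sg : R) (S : {set T}) (e : T) : e \notin S ->
  thin_kernel GG m sg S (e |: S) = sg * (1 - sg) ^+ (m - #|S|).-1
    * (#|supersets GG (e |: S)|%:R / #|supersets GG S|%:R).
Proof.
move=> eS; rewrite /thin_kernel subsetUr cardsU1 eS /= add1n.
by rewrite subSnn expr1 subnS.
Qed.

(** The probability that one step exposes at most one element. *)
Lemma thin_kernel_local_sum (R : realFieldType) (T : finType) (GG : {set {set T}})
    (m : nat) (sg : R) (S : {set T}) :
    (forall G, G \in GG -> #|G| = m) -> supersets GG S != finset.set0 ->
  thin_kernel GG m sg S S + \sum_(e | e \notin S) thin_kernel GG m sg S (e |: S)
  = (1 - sg) ^+ (m - #|S|) + (m - #|S|)%:R * (sg * (1 - sg) ^+ (m - #|S|).-1).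
Proof.
move=> szG S0; rewrite thin_kernel_stay //; congr (_ + _).
under eq_bigr => e eS do rewrite thin_kernel_ext //.
rewrite -mulr_sumr -mulr_suml -natr_sum (sum_supersets_ext _ szG) natrM mulfK.
  by rewrite mulrC.
by rewrite pnatr_eq0 cards_eq0.
Qed.

(** * Running one exposure process inside another *)

(** A coupling of one step from U and S with U below S, using only moves that
    add at most one element.  Whenever U gains e so does S, where for e in S the
    set e |: S is S itself.  The part of the transition of S towards e |: S that
    exceeds what U needs is matched with U staying put.  What is left of the
    probability that U stays is matched with S staying, up to lam: giving up lam
    absorbs the probability that S would gain two elements. *)
Definition local_coupling (R : realFieldType) (T : finType)
    (K1 K2 : {set T} -> R) (U S : {set T}) (lam : R) (U' S' : {set T}) : R :=
  \sum_(e | e \notin U) K1 (e |: U) * (U' == e |: U)%:R * (S' == e |: S)%:R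
  + (\sum_(e | e \notin S)
       (K2 (e |: S) - K1 (e |: U)) * (S' == e |: S)%:R
     + (K1 U - \sum_(e | e \notin S) (K2 (e |: S) - K1 (e |: U)) - lam)
       * (S' == S)%:R) * (U' == U)%:R.

Lemma sum_eq_indicator (R : realFieldType) (T : finType) (x : T) :
  \sum_(y : T) (y == x)%:R = 1 :> R.
Proof. by rewrite (bigD1 x) //= eqxx big1 ?addr0 // => i /negbTE ->. Qed.

(** The sets e |: U, for e outside U, differ from U and from each other. *)
Lemma local_mass_le (R : realFieldType) (T : finType) (K : {set T} -> R)
    (U U' : {set T}) (x : R) : (forall V, 0 <= K V) -> x <= K U ->
  \sum_(e | e \notin U) K (e |: U) * (U' == e |: U)%:R + x * (U' == U)%:R
  <= K U'.
Proof.
move=> K0 xK.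
have neU e : e \notin U -> (U == e |: U) = false.
  by move=> eU; apply: contraNF eU => /eqP ->; rewrite setU11.
have [->|U'U] := eqVneq U' U.
  by rewrite big1 ?add0r ?mulr1 // => e eU; rewrite neU // mulr0.
rewrite mulr0 addr0.
have [/existsP[e /andP[eU /eqP eq']]|] :=
    boolP [exists e, (e \notin U) && (U' == e |: U)]; last first.
  rewrite negb_exists => /forallP H; rewrite big1 // => e eU.
  by have := H e; rewrite eU /= => /negbTE ->; rewrite mulr0.
rewrite (bigD1 e) //= eq' eqxx mulr1 big1 ?addr0 // => e' /andP[e'U ne].
case: eqP => [eq2|]; rewrite ?mulr0 //.
have : e' \in e |: U by rewrite eq2 setU11.
by rewrite !inE (negbTE ne) (negbTE e'U).
Qed.

Lemma local_coupling_spec (R : realFieldType) (T : finType)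
    (K1 K2 : {set T} -> R) (U S : {set T}) (lam lam' : R) :
    (forall V, 0 <= K1 V) -> (forall V, 0 <= K2 V) -> U \subset S -> 0 <= lam ->
    (forall e, e \notin S -> K1 (e |: U) <= K2 (e |: S)) ->
    1 - lam <= K2 S + \sum_(e | e \notin S) K2 (e |: S) ->
    1 - lam' <= K1 U + \sum_(e | e \notin U) K1 (e |: U) <= 1 ->
    \sum_(e | e \notin S) K2 (e |: S) + lam <= K1 U ->
  [/\ subcoupling K1 K2 (local_coupling K1 K2 U S lam),
      forall U' S', local_coupling K1 K2 U S lam U' S' != 0 -> U' \subset S'
    & 1 - lam - lam' <= mass (local_coupling K1 K2 U S lam)].
Proof.
move=> K1ge K2ge US lam0 K12 HK2 /andP[HK1 HK1'] Ha.
set a := \sum_(e | e \notin S) K2 (e |: S) in HK2 Ha.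
set b := \sum_(e | e \notin U) K1 (e |: U) in HK1 HK1'.
pose D := \sum_(e | e \notin S) (K2 (e |: S) - K1 (e |: U)).
pose b' := \sum_(e | e \notin S) K1 (e |: U).
have DE : D = a - b' by rewrite /D sumrB.
have b'0 : 0 <= b' by apply: sumr_ge0.
have r0 : 0 <= K1 U - D - lam by lra.
have M1 U' : \sum_S' local_coupling K1 K2 U S lam U' S' =
    \sum_(e | e \notin U) K1 (e |: U) * (U' == e |: U)%:R
    + (K1 U - lam) * (U' == U)%:R.
  rewrite big_split /=; congr (_ + _).
    rewrite exchange_big /=; apply: eq_bigr => e _.
    by rewrite -mulr_sumr sum_eq_indicator mulr1.
  rewrite -mulr_suml big_split /= exchange_big /= -mulr_sumr sum_eq_indicator.
  under eq_bigr => e _ do rewrite -mulr_sumr sum_eq_indicator mulr1.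
  by rewrite -/D; ring.
have splitU (F : T -> R) : \sum_(e | e \notin U) F e =
    \sum_(e in S :\: U) F e + \sum_(e | e \notin S) F e.
  rewrite (bigID (mem S)) /=; congr (_ + _); apply: eq_bigl => e.
    by rewrite inE.
  by case: (boolP (e \in S)); rewrite ?andbF ?andbT //; apply/contra/(subsetP US).
split.
- split.
  + move=> U' S'; apply: addr_ge0.
      by apply: sumr_ge0 => e _; rewrite !mulr_ge0.
    rewrite mulr_ge0 // addr_ge0 //; last by rewrite mulr_ge0.
    by apply: sumr_ge0 => e eS; rewrite mulr_ge0 // subr_ge0 K12.
  + by move=> U'; rewrite M1; apply: local_mass_le => //; lra.
  + move=> S'.
    have -> : \sum_U' local_coupling K1 K2 U S lam U' S' =
       \sum_(e | e \notin S) K2 (e |: S) * (S' == e |: S)%:R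
       + (K1 U + b - a - lam) * (S' == S)%:R.
      rewrite big_split /= exchange_big /= -mulr_sumr sum_eq_indicator mulr1.
      have -> : \sum_(e | e \notin U) \sum_U' K1 (e |: U) * (U' == e |: U)%:R *
           (S' == e |: S)%:R = \sum_(e | e \notin U) K1 (e |: U) * (S' == e |: S)%:R.
        apply: eq_bigr => e _; rewrite -mulr_suml -mulr_sumr.
        by rewrite sum_eq_indicator mulr1.
      rewrite splitU -/D.
      rewrite (eq_bigr (fun e => K1 (e |: U) * (S' == S)%:R)); last first.
        move=> e; rewrite inE => /andP[_ eS].
        by have -> : e |: S = S by apply/setUidPr; rewrite sub1set.
      have bE : \sum_(e in S :\: U) K1 (e |: U) = b - b'.
        by rewrite /b splitU addrK.
      rewrite -mulr_suml bE.
      under [X in _ + _ + (X + _)]eq_bigr => e _ do rewrite mulrBl.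
      by rewrite sumrB DE; ring.
    by apply: local_mass_le => //; lra.
- move=> U' S'; rewrite /local_coupling; case: (boolP (U' \subset S')) => // US'.
  rewrite big1 ?add0r; last first.
    move=> e _; have [eU|] := eqVneq U' (e |: U); last by rewrite mulr0 mul0r.
    have [eS|] := eqVneq S' (e |: S); last by rewrite mulr0.
    by move: US'; rewrite eU eS setUS.
  have [eU|] := eqVneq U' U; last by rewrite mulr0 eqxx.
  rewrite big1 ?add0r; last first.
    move=> e _; have [eS|] := eqVneq S' (e |: S); last by rewrite mulr0.
    by move: US'; rewrite eU eS (subset_trans US) ?subsetUr.
  have [eS|] := eqVneq S' S; last by rewrite mulr0 mul0r eqxx.
  by move: US'; rewrite eU eS US.
- rewrite /mass; under eq_bigr => U' _ do rewrite M1.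
  rewrite big_split /= exchange_big /= -mulr_sumr sum_eq_indicator mulr1.
  under eq_bigr => e _ do rewrite -mulr_sumr sum_eq_indicator mulr1.
  by rewrite -/b; lra.
Qed.

(** A coupling of mu below nu that fails with probability at most x. *)
Definition embeds (R : realFieldType) (T : finType) (mu nu : {set T} -> R)
    (x : R) : Prop :=
  exists k : {set T} -> {set T} -> R,
    [/\ subcoupling mu nu k,
        forall U S, k U S != 0 -> U \subset S
      & 1 - x <= mass k].

Lemma subcoupling_le (R : realFieldType) (A B : finType)
    (mu : A -> R) (nu : B -> R) (k : A -> B -> R) a b :
  subcoupling mu nu k -> k a b <= mu a /\ k a b <= nu b.
Proof.
move=> [k0 k1 k2]; split.
  by apply: le_trans (k1 a); rewrite (bigD1 b) //= lerDl sumr_ge0.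
by apply: le_trans (k2 b); rewrite (bigD1 a) //= lerDl sumr_ge0.
Qed.

Lemma thin_supersets (R : realFieldType) (T : finType) (GG : {set {set T}})
    (m : nat) (s : R) (S : {set T}) :
  thin GG m s S != 0 -> supersets GG S != finset.set0.
Proof. by apply: contraNneq => S0; rewrite /thin S0 cards0 mul0r mulr0. Qed.

(** A step costs the probabilities that one of the two processes would gain
    two elements, and the probability that S is in a bad state, from which it
    may gain some element less readily than U does. *)
Lemma embeds_step (R : realFieldType) (T : finType) (FF GG : {set {set T}})
    (N m : nat) (p eta p' s sg s' x : R) (bad : pred {set T}) :
    (forall F, F \in FF -> #|F| = N) -> (forall G, G \in GG -> #|G| = m) ->
    (0 < #|FF|)%N ->
    0 <= p <= 1 -> 0 <= s <= 1 -> 0 <= eta <= 1 -> 0 <= sg <= 1 ->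
    1 - p' = (1 - p) * (1 - eta) -> 1 - s' = (1 - s) * (1 - sg) ->
    m%:R * sg + (m%:R * sg) ^+ 2 + N%:R * eta <= 1 ->
    (forall U S e, ~~ bad S -> supersets FF U != finset.set0 ->
      supersets GG S != finset.set0 -> U \subset S -> e \notin S ->
      thin_kernel FF N eta U (e |: U) <= thin_kernel GG m sg S (e |: S)) ->
    embeds (thin FF N p) (thin GG m s) x ->
  embeds (thin FF N p') (thin GG m s')
    (x + (m%:R * sg) ^+ 2 + (N%:R * eta) ^+ 2 + \sum_(S | bad S) thin GG m s S).
Proof.
move=> szF szG FF0 p01 s01 e01 g01 Hp Hs small Hbad [k [sk sup mk]].
pose ok (U S : {set T}) := [&& ~~ bad S, U \subset S,
  supersets FF U != finset.set0 & supersets GG S != finset.set0].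
pose lam := (m%:R * sg) ^+ 2; pose lam' := (N%:R * eta) ^+ 2.
pose K1 := thin_kernel FF N eta; pose K2 := thin_kernel GG m sg.
pose C U S := if ok U S then local_coupling (K1 U) (K2 S) U S lam
              else fun _ _ => 0.
have K1ge U V : 0 <= K1 U V by apply: thin_kernel_ge0.
have K2ge U V : 0 <= K2 U V by apply: thin_kernel_ge0.
have lam0 : 0 <= lam by apply: sqr_ge0.
have lam'0 : 0 <= lam' by apply: sqr_ge0.
have [/andP[eta0 eta1] /andP[sg0 sg1]] := (e01, g01).
have sq_le (a b : nat) (y : R) : 0 <= y -> (a <= b)%N ->
    (a%:R * y) ^+ 2 <= (b%:R * y) ^+ 2.
  by move=> y0 ab; rewrite lerXn2r ?nnegrE ?mulr_ge0 // ler_wpM2r // ler_nat.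
have HC U S : ok U S -> [/\ subcoupling (K1 U) (K2 S) (C U S),
      forall U' S', C U S U' S' != 0 -> U' \subset S'
    & 1 - lam - lam' <= mass (C U S)].
  move=> okUS; rewrite /C okUS; case/and4P: okUS => nb US FU GS.
  have /andP[BF1 BF2] := binomial_le1 (N - #|U|) e01.
  have /andP[BG1 BG2] := binomial_le1 (m - #|S|) g01.
  have LF := thin_kernel_local_sum eta szF FU.
  have LG := thin_kernel_local_sum sg szG GS.
  apply: local_coupling_spec => //.
  - by move=> e eS; apply: Hbad.
  - rewrite LG; apply: le_trans BG1; rewrite lerD2l lerN2.
    by apply: sq_le => //; apply: leq_subr.
  - rewrite LF BF2 andbT; apply: le_trans BF1; rewrite lerD2l lerN2.
    by apply: sq_le => //; apply: leq_subr.
  - move: LG; rewrite thin_kernel_stay // => /addrI; rewrite -/(K2 S) => ->.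
    rewrite /K1 thin_kernel_stay //.
    have B1 := bernoulli_le (N - #|U|) e01.
    have H1 : (N - #|U|)%:R * eta <= N%:R * eta by rewrite ler_wpM2r // ler_nat leq_subr.
    have H2 : (m - #|S|)%:R * (sg * (1 - sg) ^+ (m - #|S|).-1) <= m%:R * sg.
      apply: ler_pM => //; first by rewrite mulr_ge0 // exprn_ge0 // subr_ge0.
        by rewrite ler_nat leq_subr.
      by rewrite ler_piMr // exprn_ile1 ?subr_ge0 //; lra.
    by rewrite /lam; lra.
exists (fun U' S' => \sum_U \sum_S k U S * C U S U' S'); split.
- apply: (subcoupling_comp K1ge K2ge sk).
  + move=> U S _; case: (boolP (ok U S)) => okUS; first by have [] := HC _ _ okUS.
    rewrite /C (negbTE okUS); split=> // V; rewrite big1 //.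
  + by move=> U'; rewrite (thin_kernel_step _ szF Hp).
  + by move=> S'; rewrite (thin_kernel_step _ szG Hs).
- move=> U' S'; apply: contraR => US'; apply/eqP.
  rewrite big1 // => U _; rewrite big1 // => S _.
  case: (boolP (ok U S)) => okUS; last by rewrite /C (negbTE okUS) mulr0.
  have [_ H _] := HC _ _ okUS; suff -> : C U S U' S' = 0 by rewrite mulr0.
  by apply/eqP; apply: contraNT US' => /H.
- rewrite mass_comp.
  have [k0 k1 k2] := sk.
  apply: le_trans (_ : \sum_U \sum_S k U S * ((1 - lam - lam') - (bad S)%:R) <= _);
      last first.
    apply: ler_sum => U _; apply: ler_sum => S _.
    have [->|kUS] := eqVneq (k U S) 0; first by rewrite !mul0r.
    apply: ler_wpM2l => //.
    case: (boolP (bad S)) => bS /=.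
      rewrite /C /ok bS /= /mass big1; last by move=> i _; rewrite big1.
      by lra.
    have okUS : ok U S.
      have [l1 l2] := subcoupling_le U S sk.
      have kp : 0 < k U S by rewrite lt_def kUS k0.
      rewrite /ok bS (sup _ _ kUS) /=; apply/andP; split.
        by apply: (@thin_supersets _ _ _ N p); rewrite gt_eqF // (lt_le_trans kp).
      by apply: (@thin_supersets _ _ _ m s); rewrite gt_eqF // (lt_le_trans kp).
    by have [_ _] := HC _ _ okUS; lra.
  have mk1 : mass k <= 1.
    rewrite -(thin_sum1 p szF FF0); apply: ler_sum => U _; exact: k1.
  have -> : \sum_U \sum_S k U S * (1 - lam - lam' - (bad S)%:R) =
      mass k * (1 - lam - lam') - \sum_S \sum_U k U S * (bad S)%:R.
    have -> : \sum_S \sum_U k U S * (bad S)%:R =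
        \sum_U \sum_S k U S * (bad S)%:R by apply: exchange_big.
    rewrite /mass mulr_suml -sumrB; apply: eq_bigr => U _.
    by rewrite mulr_suml -sumrB; apply: eq_bigr => S _; ring.
  have : \sum_S \sum_U k U S * (bad S)%:R <= \sum_(S | bad S) thin GG m s S.
    rewrite [X in _ <= X]big_mkcond /=; apply: ler_sum => S _.
    rewrite -mulr_suml; case: ifP => _ /=; rewrite ?mulr0 // mulr1; exact: k2.
  move: mk mk1; rewrite -/lam -/lam'; nra.
Qed.

Lemma embeds_start (R : realFieldType) (T : finType) (FF GG : {set {set T}})
    (N m : nat) : (0 < #|FF|)%N -> (0 < #|GG|)%N ->
  embeds (thin FF N 0 : _ -> R) (thin GG m 0) 0.
Proof.
move=> FF0 GG0; have k1 (HH : {set {set T}}) (h : nat) U : (0 < #|HH|)%N ->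
    (U == finset.set0)%:R <= thin HH h (0 : R) U.
  move=> HH0; have [->|U0] := eqVneq U finset.set0; last first.
    by rewrite thin_ge0 // lexx ler01.
  rewrite /thin cards0 expr0 subr0 expr1n !mul1r.
  have -> : supersets HH finset.set0 = HH by apply/setP => G; rewrite inE sub0set andbT.
  by rewrite divff // pnatr_eq0 -lt0n.
exists (fun U S => (S == finset.set0)%:R * (U == finset.set0)%:R); split.
- split=> [U S|U|S]; first by rewrite mulr_ge0.
    by rewrite -mulr_suml sum_eq_indicator mul1r k1.
  by rewrite -mulr_sumr sum_eq_indicator mulr1 k1.
- move=> U S; have [->|] := eqVneq U finset.set0; first by rewrite sub0set.
  by rewrite mulr0 eqxx.
- rewrite /mass; under eq_bigr => U _ do rewrite -mulr_suml sum_eq_indicator mul1r.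
  by rewrite sum_eq_indicator subr0.
Qed.

(** From the current S jump to a uniform member of GG above S. *)
Lemma embeds_complete (R : realFieldType) (T : finType) (FF GG : {set {set T}})
    (N m : nat) (p s x : R) :
    (forall G, G \in GG -> #|G| = m) -> embeds (thin FF N p) (thin GG m s) x ->
  embeds (thin FF N p) (fun G => (G \in GG)%:R / #|GG|%:R) x.
Proof.
move=> szG [k [sk sup mk]].
pose K1 (U U' : {set T}) : R := (U' == U)%:R.
pose K2 (S G : {set T}) : R := (G \in supersets GG S)%:R / #|supersets GG S|%:R.
have K1ge U V : 0 <= K1 U V by [].
have K2ge U V : 0 <= K2 U V by rewrite mulr_ge0 ?invr_ge0.
have K2sum S : supersets GG S != finset.set0 -> \sum_G K2 S G = 1.
  move=> S0; rewrite -mulr_suml -natr_sum -big_mkcond sum1_card divff //.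
  by rewrite pnatr_eq0 cards_eq0.
have kS U S : k U S != 0 -> supersets GG S != finset.set0.
  move=> kUS; have [k0 _ _] := sk; have [_ l2] := subcoupling_le U S sk.
  apply: (@thin_supersets _ _ _ m s); rewrite gt_eqF //.
  by apply: lt_le_trans l2; rewrite lt_def kUS k0.
exists (fun U' G => \sum_U \sum_S k U S * (K1 U U' * K2 S G)); split.
- apply: (subcoupling_comp K1ge K2ge sk (C := fun U S U' G => K1 U U' * K2 S G)).
  + move=> U S kUS; split.
    * by move=> U' G; rewrite mulr_ge0.
    * by move=> U'; rewrite -mulr_sumr K2sum ?mulr1 // (kS U).
    * by move=> G; rewrite -mulr_suml sum_eq_indicator mul1r.
  + move=> U'; rewrite (bigD1 U') //= /K1 eqxx mulr1 big1 ?addr0 // => U UU'.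
    by rewrite eq_sym (negbTE UU') mulr0.
  + move=> G.
    have -> : (G \in GG)%:R / #|GG|%:R = \sum_(S : {set T} | S \subset G)
        s ^+ #|S| * (1 - s) ^+ (#|G| - #|S|) * ((G \in GG)%:R / #|GG|%:R) :> R.
      by rewrite -mulr_suml sum_subset_binom addrC subrK expr1n mul1r.
    rewrite [X in _ <= X]big_mkcond /=; apply: ler_sum => S _.
    rewrite /K2 /thin inE; case: (boolP (S \subset G)) => SG; last first.
      by rewrite andbF mul0r mulr0.
    case: (boolP (G \in GG)) => GGG; last by rewrite !(mul0r, mulr0).
    rewrite andbT (szG _ GGG) -[X in X <= _]mulrA; rewrite le_eqVlt; apply/orP; left; apply/eqP; congr (_ * _).
    have c0 : #|supersets GG S|%:R != 0 :> R.
      by rewrite pnatr_eq0 -lt0n; apply/card_gt0P; exists G; rewrite inE GGG.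
    have c1 : #|GG|%:R != 0 :> R.
      by rewrite pnatr_eq0 -lt0n; apply/card_gt0P; exists G.
    by field; rewrite c0 c1.
- move=> U' G; apply: contraR => US'; apply/eqP.
  rewrite big1 // => U _; rewrite big1 // => S _.
  have [->|/sup US] := eqVneq (k U S) 0; first by rewrite mul0r.
  rewrite /K1; have [U'U|_] := eqVneq U' U; last by rewrite mul0r mulr0.
  rewrite /K2 inE; case: (boolP (S \subset G)) => SG; last first.
    by rewrite andbF mul0r !mulr0.
  by move: US'; rewrite U'U (subset_trans US SG).
- rewrite (mass_comp k (fun U S U' G => K1 U U' * K2 S G)).
  apply: le_trans mk _; apply: ler_sum => U _; apply: ler_sum => S _.
  have [->|kUS] := eqVneq (k U S) 0; first by rewrite mul0r.
  rewrite /mass; under eq_bigr => U' _ do rewrite -mulr_sumr.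
  by rewrite -mulr_suml sum_eq_indicator K2sum ?(kS U) // !mulr1.
Qed.

Lemma embeds_weaken (R : realFieldType) (T : finType) (mu nu : {set T} -> R)
    (x y : R) : x <= y -> embeds mu nu x -> embeds mu nu y.
Proof.
move=> xy [k [H1 H2 H3]]; exists k; split=> //; apply: le_trans H3.
by rewrite lerD2l lerN2.
Qed.

(** At time s_j = j tau the probability of being exposed in the next step is
    sg_j = tau / (1 - s_j), which is at most tau / theta.  If e lies in G with
    conditional probability at least rho (1 - s_j), then e is exposed, and no
    other element is, with probability at least tau rho (1 - m sg_j); hence the
    factor 1 - x in the probability eta with which U gains a given element. *)
Lemma embeds_chain (R : realFieldType) (T : finType) (E0 : {set T})
    (GG : {set {set T}}) (m J : nat) (bad : nat -> pred {set T})
    (tau theta rho beta : R) (x := m%:R * tau / theta)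
    (eta := tau * (1 - x) * rho) :
    (forall G, G \in GG -> #|G| = m) -> (0 < #|GG|)%N ->
    0 < theta <= 1 -> 0 <= tau -> J%:R * tau = 1 - theta -> 0 <= rho <= 1 ->
    x + x ^+ 2 + #|E0|%:R * tau <= 1 ->
    (forall j, (j < J)%N -> \sum_(S | bad j S) thin GG m (j%:R * tau) S <= beta) ->
    (forall j S e, (j < J)%N -> ~~ bad j S -> supersets GG S != finset.set0 ->
      e \in E0 -> e \notin S ->
      rho * (1 - j%:R * tau) * #|supersets GG S|%:R
        <= #|supersets GG (e |: S)|%:R) ->
  embeds (thin [set E0] #|E0| (1 - (1 - eta) ^+ J))
         (fun G => (G \in GG)%:R / #|GG|%:R)
         (J%:R * (x ^+ 2 + (#|E0|%:R * tau) ^+ 2 + beta)).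
Proof.
move=> szG GG0 /andP[th0 th1] tau0 Jtau /andP[rho0 rho1] small Hbeta Hgood.
have x0 : 0 <= x by rewrite divr_ge0 ?mulr_ge0 // ltW.
have Nt0 : 0 <= #|E0|%:R * tau by rewrite mulr_ge0.
have x1 : x <= 1 by have := sqr_ge0 x; lra.
have eta0 : 0 <= eta by rewrite !mulr_ge0 // subr_ge0.
have eta_tau : eta <= tau.
  rewrite /eta -mulrA ler_piMr // mulr_ile1 ?subr_ge0 //; lra.
have FF0 : (0 < #|[set E0]|)%N by rewrite cards1.
have szF F : F \in [set E0] -> #|F| = #|E0| by rewrite inE => /eqP ->.
apply: (@embeds_complete _ _ _ _ _ m _ (J%:R * tau) _ szG).
suff H j : (j <= J)%N -> embeds (thin [set E0] #|E0| (1 - (1 - eta) ^+ j))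
    (thin GG m (j%:R * tau)) (j%:R * (x ^+ 2 + (#|E0|%:R * tau) ^+ 2 + beta)).
  exact: H.
elim: j => [|j IH] jJ.
  by rewrite !mul0r expr0 subrr; apply: embeds_start.
have {IH} IH := IH (ltnW jJ).
pose s : R := j%:R * tau; pose sg := tau / (1 - s).
have sth : s + tau <= 1 - theta.
  have -> : s + tau = j.+1%:R * tau by rewrite /s -natr1; ring.
  by rewrite -Jtau ler_wpM2r // ler_nat.
have s0 : 0 <= s by rewrite mulr_ge0.
have eta1 : eta <= 1 by lra.
have s1 : 0 < 1 - s by lra.
have sg0 : 0 <= sg by rewrite divr_ge0 // ltW.
have sg1 : sg <= 1 by rewrite ler_pdivrMr // mul1r; lra.
have msg : m%:R * sg <= x.
  rewrite /x /sg mulrA ler_wpM2l ?mulr_ge0 // lef_pV2 ?posrE //; lra.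
have msg0 : 0 <= m%:R * sg by rewrite mulr_ge0.
have Ne : #|E0|%:R * eta <= #|E0|%:R * tau by rewrite ler_wpM2l.
have Ne0 : 0 <= #|E0|%:R * eta by rewrite mulr_ge0.
have sq1 : (m%:R * sg) ^+ 2 <= x ^+ 2 by rewrite lerXn2r ?nnegrE.
have sq2 : (#|E0|%:R * eta) ^+ 2 <= (#|E0|%:R * tau) ^+ 2 by rewrite lerXn2r ?nnegrE.
have pw0 : 0 <= (1 - eta) ^+ j by rewrite exprn_ge0 // subr_ge0.
have pw1 : (1 - eta) ^+ j <= 1 by rewrite exprn_ile1 ?subr_ge0 //; lra.
have st := @embeds_step R T [set E0] GG #|E0| m (1 - (1 - eta) ^+ j) eta
  (1 - (1 - eta) ^+ j.+1) s sg (j.+1%:R * tau) _ (bad j) szF szG FF0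
  _ _ _ _ _ _ _ _ IH.
apply: embeds_weaken (st _ _ _ _ _ _ _ _).
- by have := Hbeta j jJ; rewrite -/s -natr1; lra.
- lra.
- lra.
- by rewrite eta0.
- by rewrite sg0.
- by rewrite exprSr; ring.
- rewrite -natr1 mulrDl mul1r -/s /sg mulrBr mulr1 mulrC divfK ?gt_eqF //; ring.
- lra.
- move=> U S e bS FU GS US eS.
  have eU : e \notin U by apply: contra eS; apply: (subsetP US).
  rewrite [X in X <= _]thin_kernel_ext //.
  case: (boolP (e \in E0)) => eE0; last first.
    have -> : supersets [set E0] (e |: U) = finset.set0.
      apply/setP => G; rewrite !inE; case: eqP => //= ->.
      by rewrite subUset sub1set (negbTE eE0).
    by rewrite cards0 mul0r mulr0 thin_kernel_ge0 ?sg0.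
  have -> : supersets [set E0] (e |: U) = supersets [set E0] U.
    apply/setP => G; rewrite !inE; case: eqP => //= ->.
    by rewrite subUset sub1set eE0.
  rewrite divff ?mulr1; last by rewrite pnatr_eq0 cards_eq0.
  rewrite thin_kernel_ext //; apply: le_trans (_ : eta <= _).
    by rewrite ler_piMr // exprn_ile1 ?subr_ge0 //; lra.
  have c0 : 0 < #|supersets GG S|%:R :> R by rewrite ltr0n lt0n cards_eq0.
  have pr : rho * (1 - s) <= #|supersets GG (e |: S)|%:R / #|supersets GG S|%:R.
    by rewrite ler_pdivlMr //; apply: Hgood.
  have -> : eta = sg * (1 - x) * (rho * (1 - s)).
    by rewrite /eta /sg; field; rewrite gt_eqF.
  apply: ler_pM => //.
  - by rewrite mulr_ge0 // subr_ge0.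
  - by rewrite mulr_ge0 // ltW.
  apply: ler_wpM2l => //.
  apply: le_trans (bernoulli_le _ _); last by rewrite sg0.
  have : (m - #|S|).-1%:R * sg <= m%:R * sg.
    by rewrite ler_wpM2r // ler_nat (leq_trans (leq_pred _)) // leq_subr.
  lra.
Qed.

(** * Switchings in graphs with given degrees *)

Local Open Scope nat_scope.

Lemma card_dep_pairs (X Y : finType) (C : {set X}) (v : X -> {set Y}) :
  #|[set q : X * Y | (q.1 \in C) && (q.2 \in v q.1)]| = \sum_(x in C) #|v x|.
Proof.
rewrite -sum1_card; under [RHS]eq_bigr => x _ do rewrite -sum1_card.
by rewrite pair_big_dep /=; apply: eq_bigl => q; rewrite inE.
Qed.

(** Double counting along reversible moves: f x y is the result of the move y
    on x, and g undoes it. *)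
Lemma injective_double_count (X Y : finType) (C0 C1 : {set X})
    (v0 v1 : X -> {set Y}) (f g : X -> Y -> X) :
    (forall x y, x \in C0 -> y \in v0 x ->
       [/\ f x y \in C1, y \in v1 (f x y) & g (f x y) y = x]) ->
  \sum_(x in C0) #|v0 x| <= \sum_(x in C1) #|v1 x|.
Proof.
move=> H; rewrite -!card_dep_pairs.
(* Keeping the move as second component makes the map injective. *)
pose h (q : X * Y) := (f q.1 q.2, q.2).
rewrite -(@card_in_imset _ _ h).
  apply/subset_leq_card/subsetP => q /imsetP[[x y]]; rewrite !inE /=.
  by move=> /andP[xC yv] ->; have [-> -> _] := H _ _ xC yv.
move=> [x y] [x' y']; rewrite !inE /= => /andP[xC yv] /andP[xC' yv'] [e1 e2].
have [_ _ gx] := H _ _ xC yv; have [_ _ gx'] := H _ _ xC' yv'.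
by rewrite -gx -gx' e1 e2.
Qed.

Definition is_graph (V : finType) (G : {set {set V}}) : bool :=
  [forall e in G, #|e| == 2].

Definition nbr (V : finType) (G : {set {set V}}) (u : V) : {set V} :=
  [set x | [set u; x] \in G].

Definition vdeg (V : finType) (G : {set {set V}}) (u : V) : nat :=
  #|[set e in G | u \in e]|.

Definition graphs_with (V : finType) (dd : V -> nat) : {set {set {set V}}} :=
  [set G | is_graph G && [forall u, vdeg G u == dd u]].

Lemma graph_edge_neq (V : finType) (G : {set {set V}}) (a b : V) :
  is_graph G -> [set a; b] \in G -> a != b.
Proof. by move=> /forall_inP gG /gG; rewrite cards2; case: (a == b). Qed.

Lemma graph_sub (V : finType) (G H : {set {set V}}) :
  is_graph G -> H \subset G -> is_graph H.
Proof.
by move=> /forall_inP gG /subsetP HG; apply/forall_inP => e /HG /gG.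
Qed.

Lemma card_nbr (V : finType) (G : {set {set V}}) (u : V) :
  is_graph G -> #|nbr G u| = vdeg G u.
Proof.
move=> gG; rewrite /vdeg -(@card_in_imset _ _ (fun x => [set u; x])).
  apply: eq_card => e; rewrite !inE; apply/imsetP/andP.
    by move=> [x]; rewrite inE => xG ->; rewrite xG !inE eqxx.
  move=> [eG ue]; have /cards2P[a [b [ab E]]] := forall_inP gG _ eG.
  move: ue; rewrite E !inE => /orP[] /eqP ->.
    by exists b; rewrite ?inE -?E.
  by exists a; rewrite ?inE setUC -?E.
move=> x y; rewrite !inE => xG yG E.
have := graph_edge_neq gG xG; have := graph_edge_neq gG yG => uy ux.
have : x \in [set u; y] by rewrite -E !inE eqxx orbT.
by rewrite !inE eq_sym (negbTE ux) => /eqP.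
Qed.

Lemma vdeg_sum (V : finType) (G : {set {set V}}) (u : V) :
  vdeg G u = \sum_(e in G) (u \in e).
Proof.
rewrite /vdeg -sum1_card big_mkcond [RHS]big_mkcond /=; apply: eq_bigr => e _.
by rewrite inE; case: (e \in G); case: (u \in e).
Qed.

Lemma handshake (V : finType) (G : {set {set V}}) :
  is_graph G -> \sum_u vdeg G u = 2 * #|G|.
Proof.
move=> /forall_inP gG; under eq_bigr => u _ do rewrite vdeg_sum.
rewrite exchange_big /= -sum1_card big_distrr /=; apply: eq_bigr => e eG.
rewrite muln1 -(eqP (gG _ eG)) -sum1_card [RHS]big_mkcond /=.
by apply: eq_bigr => u _; case: (u \in e).
Qed.

Lemma vdeg_setD (V : finType) (G S : {set {set V}}) (u : V) : S \subset G ->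
  vdeg (G :\: S) u + vdeg S u = vdeg G u.
Proof.
by move=> SG; rewrite !vdeg_sum [RHS](big_setID S) /= (setIidPr SG) addnC.
Qed.

Definition switch (V : finType) (G : {set {set V}}) (a b c d : V) :
    {set {set V}} :=
  (G :\: [set [set a; b]; [set c; d]]) :|: [set [set a; c]; [set b; d]].

Definition switchable (V : finType) (G : {set {set V}}) (a b c d : V) : bool :=
  [&& [set a; b] \in G, [set c; d] \in G, [set a; c] \notin G,
      [set b; d] \notin G, a != c & b != d].

Lemma switchK (V : finType) (G : {set {set V}}) (a b c d : V) :
  switchable G a b c d -> switch (switch G a b c d) a c b d = G.
Proof.
move=> /and5P[ab cd ac bd _]; apply/setP => e; rewrite !inE.
have [->|Nab] := eqVneq e [set a; b]; first by rewrite ab !orbT.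
have [->|Ncd] := eqVneq e [set c; d]; first by rewrite cd !orbT.
rewrite /= !orbF; have [->|Nac] := eqVneq e [set a; c]; first by rewrite (negbTE ac).
have [->|Nbd] := eqVneq e [set b; d]; first by rewrite (negbTE bd).
by case: (e \in G).
Qed.

Lemma mem_set2 (V : finType) (a b v : V) : a != b ->
  (v \in [set a; b]) = (v == a) + (v == b) :> nat.
Proof.
move=> ab; rewrite !inE; have [->|] //= := eqVneq v a; by rewrite (negbTE ab).
Qed.

Lemma set2_eqF (V : finType) (a b c d : V) : a != c -> a != d ->
  [set a; b] != [set c; d].
Proof.
move=> ac ad; apply: contraNneq ac => E.
have : a \in [set c; d] by rewrite -E !inE eqxx.
by rewrite !inE (negbTE ad) orbF.
Qed.

Lemma switch_graph (V : finType) (G : {set {set V}}) (a b c d : V) :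
  is_graph G -> switchable G a b c d ->
  is_graph (switch G a b c d) /\ forall v, vdeg (switch G a b c d) v = vdeg G v.
Proof.
move=> gG /and5P[ab cd ac bd /andP[nac nbd]].
have nab := graph_edge_neq gG ab; have ncd := graph_edge_neq gG cd.
have nad : a != d by apply: contraNneq ac => ->; rewrite setUC.
have nbc : b != c by apply: contraNneq ac => <-.
split.
  apply/forall_inP => e; rewrite !inE => /orP[/andP[_ eG]|].
    exact: (forall_inP gG).
  by move=> /orP[] /eqP ->; rewrite cards2 ?nac ?nbd.
move=> v; rewrite !vdeg_sum /switch.
set D := [set [set a; b]; [set c; d]]; set N := [set [set a; c]; [set b; d]].
have DG : D \subset G by rewrite subUset !sub1set ab cd.
have dis : [disjoint G :\: D & N].
  rewrite disjoint_sym; apply/pred0P => e /=; rewrite !inE.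
  have [->|_] := eqVneq e [set a; c]; first by rewrite (negbTE ac) andbF.
  have [->|_] := eqVneq e [set b; d]; first by rewrite (negbTE bd) andbF.
  by [].
rewrite (eq_bigl [predU G :\: D & N]); last by move=> e; rewrite !inE.
rewrite bigU //=.
rewrite [RHS](big_setID D) /= (setIidPr DG) addnC; congr (_ + _).
rewrite !big_setU1 ?in_set1 ?set2_eqF // !big_set1 !mem_set2 //=; exact: addnACA.
Qed.

Lemma switch_graphs_with (V : finType) (dd : V -> nat) (G : {set {set V}})
    (a b c d : V) :
  G \in graphs_with dd -> switchable G a b c d ->
  switch G a b c d \in graphs_with dd.
Proof.
rewrite !inE => /andP[gG /forallP dG] sw.
have [-> H] := switch_graph gG sw.
by apply/forallP => u; rewrite H.
Qed.

(** The inner vertices of the walks of length three from u to v. *)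
Definition path3 (V : finType) (G : {set {set V}}) (u v : V) : {set V * V} :=
  [set q | [&& q.1 \in nbr G u, q.2 \in nbr G v & [set q.1; q.2] \in G]].

Definition crowded (V : finType) (dd : V -> nat) (k : nat) : {set {set {set V}}} :=
  [set G in graphs_with dd | [exists u, exists v, k < #|path3 G u v|]].

Definition edge_pairs (V : finType) (G : {set {set V}}) : {set V * V} :=
  [set q | [set q.1; q.2] \in G].

Lemma card_edge_pairs (V : finType) (G : {set {set V}}) :
  is_graph G -> #|edge_pairs G| = \sum_u vdeg G u.
Proof.
move=> gG; have := card_dep_pairs finset.setT (nbr G).
under eq_bigl => x do rewrite inE.
under eq_bigr => x _ do rewrite card_nbr //.
by move=> <-; apply: eq_card => q; rewrite !inE.
Qed.

Lemma graphs_with_vdeg (V : finType) (dd : V -> nat) (G : {set {set V}}) (u : V) :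
  G \in graphs_with dd -> vdeg G u = dd u.
Proof. by rewrite inE => /andP[_ /forallP /(_ u) /eqP]. Qed.

Lemma graphs_with_graph (V : finType) (dd : V -> nat) (G : {set {set V}}) :
  G \in graphs_with dd -> is_graph G.
Proof. by rewrite inE => /andP[]. Qed.

Lemma residual_vdeg (V : finType) (dd : V -> nat) (G S : {set {set V}}) (u : V) :
  G \in graphs_with dd -> S \subset G -> vdeg (G :\: S) u = dd u - vdeg S u.
Proof.
move=> /(graphs_with_vdeg u) <- SG; by rewrite -(vdeg_setD u SG) addnK.
Qed.

(** In a graph above S without uv, choose unexposed edges ux, vy with x != y and
    xy not an edge, and replace them by uv and xy.  The result has the same
    degrees, contains S and uv, and (x, y) recovers the original graph; it is an
    oriented edge outside S, which leaves at most \sum_w r w choices.  Conversely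
    r u * r v choices of (x, y) lose at most D to x = y, and at most k to edges
    xy, unless the graph is crowded. *)
Lemma switching_lower (V : finType) (dd : V -> nat) (D k : nat)
    (S : {set {set V}}) (u v : V) (r := fun w => dd w - vdeg S w) :
    (forall w, dd w <= D) -> u != v -> [set u; v] \notin S ->
  #|supersets (graphs_with dd) S| * (r u * r v)
  <= #|supersets (graphs_with dd) ([set u; v] |: S)| * (\sum_w r w + r u * r v)
     + #|supersets (graphs_with dd) S| * (D + k)
     + D ^ 2 * #|supersets (crowded dd k) S|.
Proof.
move=> dD uv uvS; set H := supersets _ S; set H1 := supersets _ (_ |: S).
have HP G : G \in H -> [/\ G \in graphs_with dd, is_graph G & S \subset G].
  by rewrite inE => /andP[GG ->]; split=> //; apply: (graphs_with_graph GG).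
pose C0 := H :\: H1.
pose v1 G := edge_pairs (G :\: S).
pose v0 G := [set q : V * V | [&& q.1 \in nbr (G :\: S) u, q.2 \in nbr (G :\: S) v,
                q.1 != q.2 & [set q.1; q.2] \notin G]].
have H1H : H1 \subset H by apply: supersetsS; apply: subsetUr.
have inC0 G : G \in C0 -> G \in H /\ [set u; v] \notin G.
  rewrite in_setD => /andP[GH1 GH]; split=> //; apply: contra GH1 => uvG.
  by have [gG _ SG] := HP _ GH; rewrite inE gG subUset sub1set uvG.
have count : \sum_(G in C0) #|v0 G| <= \sum_(G in H1) #|v1 G|.
  apply: (@injective_double_count _ _ _ _ _ _
    (fun G q => switch G u q.1 v q.2) (fun G q => switch G u v q.1 q.2)).
  move=> G [x y] /inC0[GH uvG]; rewrite inE /= => /and4P[xu yv xy xyG].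
  have [GG gG SG] := HP _ GH.
  have /andP[uxS uxG] : ([set u; x] \notin S) && ([set u; x] \in G).
    by move: xu; rewrite !in_set.
  have /andP[vyS vyG] : ([set v; y] \notin S) && ([set v; y] \in G).
    by move: yv; rewrite !in_set.
  have sw : switchable G u x v y by apply/and5P; split; rewrite ?uv.
  have xyS : [set x; y] \notin S by apply: contra xyG; apply: (subsetP SG).
  split; last exact: switchK.
  - rewrite /= /H1 /H /supersets in_set (switch_graphs_with GG sw) subUset sub1set /= /switch !inE eqxx orbT /=.
    apply/subsetP => e eS; rewrite !inE (subsetP SG _ eS) andbT negb_or.
    by apply/orP; left; apply/andP; split; apply: contraTneq eS => ->.
  - by rewrite /v1 /= /switch !inE /= xyS eqxx !orbT.
have sumv1 : \sum_(G in H1) #|v1 G| = #|H1| * \sum_w r w.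
  rewrite -sum1_card big_distrl /=; apply: eq_bigr => G GH1; rewrite mul1n.
  have [GG gG SG] := HP _ (subsetP H1H _ GH1).
  rewrite card_edge_pairs; last by apply: graph_sub gG _; apply: subsetDl.
  by apply: eq_bigr => w _; apply: residual_vdeg.
have v0_ge G : G \in C0 -> r u * r v <= #|v0 G| + (D + #|path3 G u v|).
  move=> /inC0[GH uvG]; have [GG gG SG] := HP _ GH.
  have gGS : is_graph (G :\: S) by apply: graph_sub gG _; apply: subsetDl.
  have -> : r u * r v = #|setX (nbr (G :\: S) u) (nbr (G :\: S) v)|.
    by rewrite cardsX !card_nbr // !(residual_vdeg _ GG SG).
  have diag : #|[set (x, x) | x in nbr G u]| <= D.
    apply: leq_trans (leq_imset_card _ _) _.
    by rewrite card_nbr // (graphs_with_vdeg u GG).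
  apply: leq_trans (_ : #|v0 G :|: ([set (x, x) | x in nbr G u] :|: path3 G u v)| <= _).
    apply/subset_leq_card/subsetP => [[x y]]; rewrite !inE /=.
    move=> /andP[/andP[uxS uxG] /andP[vyS vyG]].
    rewrite uxS uxG vyS vyG /=; case: (boolP ([set x; y] \in G)) => xyG /=.
      by rewrite !orbT.
    rewrite andbT orbF; case: (eqVneq x y) => //= <-.
    by apply/imsetP; exists x; rewrite ?inE.
  apply: leq_trans (leq_card_setU _ _) _; rewrite leq_add2l.
  by apply: leq_trans (leq_card_setU _ _) _; rewrite leq_add2r.
have path3_le G : G \in H -> #|path3 G u v| <= D ^ 2.
  move=> /HP[GG gG _].
  apply: leq_trans (_ : #|setX (nbr G u) (nbr G v)| <= _).
    by apply/subset_leq_card/subsetP => q; rewrite !inE => /and3P[-> ->].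
  rewrite cardsX !card_nbr // !(graphs_with_vdeg _ GG).
  by rewrite -mulnn leq_mul.
have sumpath : \sum_(G in C0) #|path3 G u v| <= #|H| * k + D ^ 2 * #|supersets (crowded dd k) S|.
  apply: leq_trans (_ : \sum_(G in H) (k + D ^ 2 * (G \in supersets (crowded dd k) S)) <= _).
    apply: leq_trans (_ : \sum_(G in H) #|path3 G u v| <= _).
      rewrite [X in _ <= X](big_setID H1) /= -/C0; exact: leq_addl.
    apply: leq_sum => G GH; case: (leqP #|path3 G u v| k) => pk.
      exact: leq_trans pk (leq_addr _ _).
    apply: leq_trans (path3_le _ GH) _.
    have [GG _ SG] := HP _ GH.
    have -> : G \in supersets (crowded dd k) S.
      rewrite inE SG andbT inE GG /=; apply/existsP; exists u.
      by apply/existsP; exists v.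
    by rewrite muln1 leq_addl.
  rewrite big_split /= sum_nat_const leq_add2l -big_distrr /= leq_mul2l.
  apply/orP; right; rewrite -sum1_card big_mkcond [X in _ <= X]big_mkcond /=.
  by apply: leq_sum => G _; case: (G \in H); case: (G \in supersets _ _).
have cC0 : #|H| = #|H1| + #|C0|.
  by rewrite -(cardsID H1 H) (setIidPr H1H).
have C0H : #|C0| <= #|H| by apply/subset_leq_card/subsetDl.
rewrite {1}cC0 mulnDl mulnDr -!addnA [X in _ <= X]addnCA leq_add2l.
have -> : #|C0| * (r u * r v) = \sum_(G in C0) (r u * r v) by rewrite sum_nat_const.
apply: leq_trans (leq_sum _ v0_ge) _; rewrite !big_split /= sum_nat_const.
rewrite -sumv1 leq_add // mulnDr -addnA leq_add //.
by rewrite leq_mul2r C0H orbT.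
Qed.

(** The reverse switching: in a graph containing F and uv, choose an oriented
    edge xy outside F with x not in the closed neighbourhood of u and y not in
    that of v, and replace uv, xy by ux, vy.  Each excluded kind of pair costs at
    most (D + 1) D, and the result determines (x, y) up to D ^ 2 choices. *)
Lemma switching_upper (V : finType) (dd : V -> nat) (D m : nat)
    (F : {set {set V}}) (u v : V) :
    (forall w, dd w <= D) -> \sum_w dd w = 2 * m -> u != v -> [set u; v] \notin F ->
  #|supersets (graphs_with dd) ([set u; v] |: F)| * (2 * m - 2 * #|F| - 2 * (D.+1 * D))
  <= #|supersets (graphs_with dd) F| * D ^ 2.
Proof.
move=> dD dm uv uvF; set H := supersets _ F; set H1 := supersets _ (_ |: F).
have HP G : G \in H -> [/\ G \in graphs_with dd, is_graph G & F \subset G].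
  by rewrite inE => /andP[GG ->]; split=> //; apply: (graphs_with_graph GG).
have H1H : H1 \subset H by apply: supersetsS; apply: subsetUr.
pose bad G := [set q : V * V | (q.1 \in u |: nbr G u) && (q.2 \in nbr G q.1)]
  :|: [set q : V * V | (q.2 \in v |: nbr G v) && (q.1 \in nbr G q.2)].
pose v0 G := edge_pairs (G :\: F) :\: bad G.
pose v1 G := setX (nbr G u) (nbr G v).
have count : \sum_(G in H1) #|v0 G| <= \sum_(G in H) #|v1 G|.
  apply: (@injective_double_count _ _ _ _ _ _
    (fun G q => switch G u v q.1 q.2) (fun G q => switch G u q.1 v q.2)).
  move=> G [x y] GH1; have [GG gG FG] := HP _ (subsetP H1H _ GH1).
  have uvG : [set u; v] \in G.
    by move: GH1; rewrite inE subUset sub1set => /and3P[].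
  rewrite in_setD => /andP[nb]; rewrite in_set /= in_setD => /andP[xyF xyG].
  have [[xu uxG] [yv vyG]] : (x != u /\ [set u; x] \notin G) /\
      (y != v /\ [set v; y] \notin G).
    move: nb; rewrite !inE /= (setUC [set y]) xyG !andbT !negb_or.
    by move=> /andP[/andP[-> ->] /andP[-> ->]].
  have sw : switchable G u v x y.
    by apply/and5P; split => //; rewrite eq_sym xu eq_sym yv.
  split; last exact: switchK.
  - rewrite /= /H1 /H /supersets in_set (switch_graphs_with GG sw) /=.
    apply/subsetP => e eF; rewrite /switch !inE (subsetP FG _ eF) andbT negb_or.
    by apply/orP; left; apply/andP; split; apply: contraTneq eF => ->.
  - by rewrite /v1 /= /switch !inE /= !eqxx !orbT.
have sumv1 : \sum_(G in H) #|v1 G| <= #|H| * D ^ 2.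
  rewrite -sum_nat_const; apply: leq_sum => G /HP[GG gG _].
  by rewrite cardsX !card_nbr // !(graphs_with_vdeg _ GG) -mulnn leq_mul.
have bad1 G w : G \in H ->
    #|[set q : V * V | (q.1 \in w |: nbr G w) && (q.2 \in nbr G q.1)]| <= D.+1 * D.
  move=> /HP[GG gG _]; rewrite card_dep_pairs.
  apply: leq_trans (_ : \sum_(x in w |: nbr G w) D <= _).
    by apply: leq_sum => x _; rewrite card_nbr // (graphs_with_vdeg _ GG).
  rewrite sum_nat_const leq_mul2r; apply/orP; right.
  rewrite cardsU1 -add1n leq_add ?leq_b1 //.
  by rewrite card_nbr // (graphs_with_vdeg _ GG).
have bad2 G w : G \in H ->
    #|[set q : V * V | (q.2 \in w |: nbr G w) && (q.1 \in nbr G q.2)]| <= D.+1 * D.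
  move=> GH; apply: leq_trans (bad1 _ w GH).
  rewrite -(@card_imset _ _ (fun q : V * V => (q.2, q.1))); last first.
    by move=> [a b] [c d] [-> ->].
  apply/subset_leq_card/subsetP => q /imsetP[q']; by rewrite inE => Hq ->; rewrite inE.
have v0_ge G : G \in H1 -> 2 * m - 2 * #|F| - 2 * (D.+1 * D) <= #|v0 G|.
  move=> /(subsetP H1H) GH; have [GG gG FG] := HP _ GH.
  have gGF : is_graph (G :\: F) by apply: graph_sub gG _; apply: subsetDl.
  have -> : 2 * m - 2 * #|F| = #|edge_pairs (G :\: F)|.
    rewrite card_edge_pairs // handshake // cardsDS // mulnBr -(handshake gG) -dm.
    by congr (_ - _); apply: eq_bigr => w _; rewrite (graphs_with_vdeg _ GG).
  rewrite leq_subLR.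
  rewrite -(cardsID (bad G) (edge_pairs (G :\: F))) leq_add2r.
  apply: leq_trans (subset_leq_card (subsetIr _ _)) _.
  apply: leq_trans (leq_card_setU _ _) _.
  by rewrite mul2n -addnn leq_add ?bad1 ?bad2.
apply: leq_trans sumv1; apply: leq_trans count.
by rewrite -sum_nat_const; apply: leq_sum.
Qed.

(** A uniform graph with degrees dd contains F with probability at most
    (D ^ 2 / A) ^ #|F|: insert the edges of F one by one, each costing a factor
    D ^ 2 / A by switching_upper. *)
Lemma card_supersets_le (V : finType) (dd : V -> nat) (D m A : nat)
    (F : {set {set V}}) :
    (forall w, dd w <= D) -> \sum_w dd w = 2 * m ->
    A <= 2 * m - 2 * #|F| - 2 * (D.+1 * D) ->
  #|supersets (graphs_with dd) F| * A ^ #|F| <= #|graphs_with dd| * (D ^ 2) ^ #|F|.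
Proof.
move=> dD dm; move: {2}#|F| (erefl #|F|) => f; elim: f F => [|f IH] F cF HA.
  rewrite cF !muln1; apply/subset_leq_card/subsetP => G.
  by rewrite inE => /andP[].
have [e eF] : exists e, e \in F by apply/card_gt0P; rewrite cF.
have [gF|ngF] := boolP (is_graph F); last first.
  have -> : #|supersets (graphs_with dd) F| = 0; last by [].
  apply/eqP; rewrite cards_eq0; apply/eqP/setP => G; rewrite !inE.
  apply/negP => /andP[/andP[gG _] FG]; case/negP: ngF; exact: graph_sub gG FG.
have [u [v [uv eE]]] : exists u v, u != v /\ e = [set u; v].
  exact/cards2P/(forall_inP gF).
have cF' : #|F :\ e| = f by move: (cardsD1 e F); rewrite eF cF => [[->]].
have FE : F = [set u; v] |: (F :\ e) by rewrite -eE setD1K.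
have uvF : [set u; v] \notin F :\ e by rewrite -eE !inE eqxx.
have := switching_upper dD dm uv uvF; rewrite -FE => up.
have HA' : A <= 2 * m - 2 * #|F :\ e| - 2 * (D.+1 * D).
  apply: leq_trans HA _; apply: leq_sub2r; apply: leq_sub2l.
  by rewrite leq_mul2l cF cF' leqnSn.
have := IH _ cF' HA'; rewrite cF cF'.
move: up; set B := (D ^ 2)%N; move: B => B up; rewrite !(expnSr _ f) !mulnA => IH'.
apply: leq_trans (_ : #|supersets (graphs_with dd) (F :\ e)| * A ^ f * B <= _); last first.
  by rewrite leq_mul2r IH' orbT.
rewrite mulnAC [X in _ <= X]mulnAC leq_mul2r.
apply/orP; right; apply: leq_trans up; rewrite leq_mul2l; apply/orP; right.
exact: HA'.
Qed.

(** Let f and g enumerate the neighbourhoods of the two ends of more than k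
    walks of length three.  The middle edges of these walks are of the form
    {f i, g j}; as every edge is traversed in at most two directions, there are
    at least h of them.  The bound is a union bound over f, g and the set of
    index pairs (i, j) that give edges. *)
Lemma crowded_le (V : finType) (dd : V -> nat) (D m A k h : nat) :
    (forall w, dd w <= D) -> \sum_w dd w = 2 * m ->
    A <= 2 * m - 2 * D ^ 2 - 2 * (D.+1 * D) -> D ^ 2 <= A -> 0 < A ->
    2 * h <= k.+1 ->
  #|crowded dd k| * A ^ h
  <= (#|V| ^ D * #|V| ^ D * 2 ^ (D ^ 2)) * (#|graphs_with dd| * (D ^ 2) ^ h).
Proof.
move=> dD dm HA DA A0 hk.
pose P := ({ffun 'I_D -> V} * {ffun 'I_D -> V} * {set 'I_D * 'I_D})%type.
pose F (p : P) : {set {set V}} := [set [set p.1.1 z.1; p.1.2 z.2] | z in p.2].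
have cP : #|{: P}| = #|V| ^ D * #|V| ^ D * 2 ^ (D ^ 2).
  rewrite !card_prod !card_ffun !card_ord; congr (_ * _).
  rewrite -cardsT -powersetT card_powerset cardsT card_prod !card_ord mulnn //.
have FD p : #|F p| <= D ^ 2.
  apply: leq_trans (leq_imset_card _ _) _.
  by apply: leq_trans (max_card _) _; rewrite card_prod !card_ord mulnn.
have each p : h <= #|F p| ->
    #|supersets (graphs_with dd) (F p)| * A ^ h <= #|graphs_with dd| * (D ^ 2) ^ h.
  move=> hF; have HA' : A <= 2 * m - 2 * #|F p| - 2 * (D.+1 * D).
    apply: leq_trans HA _; apply: leq_sub2r; apply: leq_sub2l.
    by rewrite leq_mul2l FD.
  have := card_supersets_le dD dm HA'.
  move: DA; set B := (D ^ 2)%N; move: B => B DA.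
  rewrite -(subnK hF) addnC !expnD !mulnA => H.
  rewrite -(@leq_pmul2r (A ^ (#|F p| - h))) ?expn_gt0 ?A0 //.
  apply: leq_trans H _; rewrite leq_mul2l; apply/orP; right.
  by case: (#|F p| - h) => // x; rewrite leq_exp2r.
have cover : crowded dd k \subset
    \bigcup_(p : P | h <= #|F p|) supersets (graphs_with dd) (F p).
  apply/subsetP => G; rewrite inE => /andP[GG /existsP[u /existsP[v Hk]]].
  have gG := graphs_with_graph GG.
  (* Beyond the degree the default value repeats an end of the walk, which is
     harmless as only index pairs giving edges of G enter Z. *)
  pose f := [ffun i : 'I_D => nth u (enum (nbr G u)) i].
  pose g := [ffun i : 'I_D => nth v (enum (nbr G v)) i].
  pose Z := [set z : 'I_D * 'I_D | [set f z.1; g z.2] \in G].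
  have FG : F (f, g, Z) \subset G.
    by apply/subsetP => e /imsetP[z]; rewrite inE => zG ->.
  have inord w x : x \in nbr G w -> exists i : 'I_D, nth w (enum (nbr G w)) i = x.
    move=> xw; have ix : index x (enum (nbr G w)) < D.
      apply: leq_trans (_ : size (enum (nbr G w)) <= _).
        by rewrite index_mem mem_enum.
      by rewrite -cardE card_nbr // (graphs_with_vdeg w GG).
    by exists (Ordinal ix); rewrite /= nth_index // mem_enum.
  apply/bigcupP; exists (f, g, Z); last by rewrite inE GG.
  have gF := graph_sub gG FG.
  have := card_edge_pairs gF; rewrite handshake // => cF.
  have : k < 2 * #|F (f, g, Z)|.
    rewrite -cF; apply: leq_trans Hk _; apply/subset_leq_card/subsetP => [[x y]].
    rewrite inE /= => /and3P[xu yv xyG]; rewrite inE /=.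
    have [i ix] := inord _ _ xu; have [j jy] := inord _ _ yv.
    apply/imsetP; exists (i, j); last by rewrite /= !ffunE ix jy.
    by rewrite inE /= !ffunE ix jy.
  by move=> kF; rewrite -(leq_pmul2l (isT : 0 < 2)) (leq_trans hk kF).
have card_cup (I : finType) (Q : pred I) (B : I -> {set {set {set V}}}) :
    #|\bigcup_(i | Q i) B i| <= \sum_(i | Q i) #|B i|.
  elim/big_rec2: _ => [|i a b _ IH]; first by rewrite cards0.
  by apply: leq_trans (leq_card_setU _ _) _; rewrite leq_add2l.
apply: leq_trans (_ : (\sum_(p : P | h <= #|F p|)
   #|supersets (graphs_with dd) (F p)|) * A ^ h <= _).
  rewrite leq_mul2r; apply/orP; right.
  exact: leq_trans (subset_leq_card cover) (card_cup _ _ _).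
rewrite big_distrl /= -cP -sum_nat_const.
rewrite big_mkcond /=; apply: leq_sum => p _; case: ifP => // hF; exact: each.
Qed.

Local Open Scope ring_scope.

(** * Typical states of the exposure of a random graph *)

(** Because exp (- x) >= 1 - x and (1 + x + 2 x^2) (1 - x) = 1 + x^2 (1 - 2 x). *)
Lemma expR_quadratic (R : realType) (x : R) :
  x <= 1 / 2 -> expR x <= 1 + x + 2 * x ^+ 2.
Proof.
move=> x2; have e1 : 1 - x <= expR (- x) by exact: expR_ge1Dx.
have e2 : 0 < expR (- x) by apply: expR_gt0.
have -> : expR x = (expR (- x))^-1 by rewrite expRN invrK.
rewrite -[X in X <= _]mul1r ler_pdivrMr //.
have : 0 <= x ^+ 2 * (1 - 2 * x) by rewrite mulr_ge0 ?sqr_ge0 //; lra.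
have : 0 <= (1 + x + 2 * x ^+ 2) * (expR (- x) - (1 - x)).
  by rewrite mulr_ge0 ?subr_ge0 //; nra.
by lra.
Qed.

(** The generating function of the number of unexposed elements of D, which is
    binomial with parameters #|D| and 1 - s. *)
Lemma thin_moment (R : comRingType) (T : finType) (G D : {set T}) (s z : R) :
  D \subset G ->
  \sum_(S : {set T} | S \subset G)
     s ^+ #|S| * (1 - s) ^+ (#|G| - #|S|) * z ^+ #|D :\: S|
  = (1 + (1 - s) * (z - 1)) ^+ #|D|.
Proof.
move=> DG; pose f (i : T) := s; pose g i := (1 - s) * (if i \in D then z else 1).
transitivity (\prod_(i in G) (f i + g i)).
  rewrite -sum_subset_prod; apply: eq_bigr => S SG.
  rewrite -(prod_subset_const _ _ SG).
  have -> : z ^+ #|D :\: S| = \prod_(i in G) (if i \in D :\: S then z else 1).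
    rewrite prod_subset_const ?expr1n ?mulr1 //.
    by apply: subset_trans DG; apply: subsetDl.
  rewrite -big_split /=; apply: eq_bigr => i _; rewrite /f /g inE.
  by case: (i \in S); rewrite //= mulr1.
rewrite (big_setID D) /= (setIidPr DG) [X in _ * X]big1 ?mulr1; last first.
  by move=> i; rewrite inE /f /g => /andP[/negbTE -> _]; ring.
rewrite -prodr_const; apply: eq_bigr => i iD; rewrite /f /g iD; ring.
Qed.

(** The Chernoff bound for the number of unexposed elements of D, for both
    tails at once: a positive x gives the upper tail and a negative x the
    lower one. *)
Lemma thin_tail (R : realType) (T : finType) (G D : {set T}) (s x : R) :
    D \subset G -> 0 <= s <= 1 -> x <= 1 / 2 ->
  \sum_(S : {set T} | (S \subset G) &&
        ((x + 3 * x ^+ 2) * ((1 - s) * #|D|%:R) <= x * #|D :\: S|%:R))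
     s ^+ #|S| * (1 - s) ^+ (#|G| - #|S|)
  <= expR (- (x ^+ 2 * ((1 - s) * #|D|%:R))).
Proof.
move=> DG /andP[s0 s1] x2; set q := 1 - s; set k : R := #|D|%:R.
have q0 : 0 <= q by rewrite subr_ge0.
have w0 (S : {set T}) : 0 <= s ^+ #|S| * q ^+ (#|G| - #|S|) by rewrite mulr_ge0 ?exprn_ge0.
pose z := expR x.
apply: le_trans (_ : \sum_(S : {set T} | S \subset G)
   s ^+ #|S| * q ^+ (#|G| - #|S|) * z ^+ #|D :\: S|
     * expR (- ((x + 3 * x ^+ 2) * (q * k))) <= _).
  rewrite [X in _ <= X](bigID (fun S : {set T} =>
     (x + 3 * x ^+ 2) * (q * k) <= x * #|D :\: S|%:R)) /=.
  apply: le_trans (_ : _ <= \sum_(S : {set T} | (S \subset G) &&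
        ((x + 3 * x ^+ 2) * (q * k) <= x * #|D :\: S|%:R))
     s ^+ #|S| * q ^+ (#|G| - #|S|) * z ^+ #|D :\: S|
     * expR (- ((x + 3 * x ^+ 2) * (q * k)))) _.
    apply: ler_sum => S /andP[_ H]; rewrite -mulrA ler_peMr //.
    rewrite /z -expRM_natr -expRD -[X in X <= _]expR0 ler_expR.
    by rewrite subr_ge0.
  rewrite lerDl; apply: sumr_ge0 => S _.
  by rewrite !mulr_ge0 ?w0 ?exprn_ge0 ?expR_ge0.
rewrite -mulr_suml thin_moment //.
apply: le_trans (_ : expR (q * (z - 1)) ^+ #|D| * expR (- ((x + 3 * x ^+ 2) * (q * k))) <= _).
  rewrite ler_wpM2r ?expR_ge0 // lerXn2r ?nnegrE ?expR_ge0 //; last exact: expR_ge1Dx.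
  have : 0 <= z by apply: expR_ge0.
  by rewrite -/q /q; nra.
rewrite -expRM_natr -expRD ler_expR -/k.
have qk : 0 <= q * k by rewrite mulr_ge0.
have := ler_wpM2r qk (expR_quadratic x2); rewrite -/z.
lra.
Qed.

Definition irregular (R : realType) (V : finType) (dd : V -> nat) (sg s : R)
    (S : {set {set V}}) : bool :=
  [exists v, ((dd v - vdeg S v)%N%:R <= (1 - 3 * sg) * ((1 - s) * (dd v)%:R))
          || ((1 + 3 * sg) * ((1 - s) * (dd v)%:R) <= (dd v - vdeg S v)%N%:R)].

(** Conditionally on containing S, a graph with degrees dd is crowded with
    probability more than beta. *)
Definition overcrowded (R : realType) (V : finType) (dd : V -> nat) (k : nat)
    (beta : R) (S : {set {set V}}) : bool :=
  beta * #|supersets (graphs_with dd) S|%:R < #|supersets (crowded dd k) S|%:R.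

(** The residual degree of v is the number of unexposed edges among the dd v
    edges at v, so the Chernoff bound applies to it for every G; the rest is a
    union bound over v and the two tails. *)
Lemma thin_irregular (R : realType) (V : finType) (dd : V -> nat) (m : nat)
    (sg s delta : R) :
    (forall G, G \in graphs_with dd -> #|G| = m) ->
    0 < sg <= 1 / 2 -> 0 <= s <= 1 -> (forall v, delta <= (dd v)%:R) ->
  \sum_(S | irregular dd sg s S) thin (graphs_with dd) m s S
  <= 2 * #|V|%:R * expR (- (sg ^+ 2 * ((1 - s) * delta))).
Proof.
move=> szG /andP[sg0 sg2] s01 dlt; have /andP[s0 s1] := s01.
set GG := graphs_with dd in szG *; set b := 2 * _ * _.
have q0 : 0 <= 1 - s by rewrite subr_ge0.
have b0 : 0 <= b by rewrite !mulr_ge0 ?expR_ge0.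
pose w (G S : {set {set V}}) := s ^+ #|S| * (1 - s) ^+ (#|G| - #|S|).
have w0 G S : 0 <= w G S by rewrite mulr_ge0 ?exprn_ge0.
have inner G : G \in GG ->
    \sum_(S : {set {set V}} | S \subset G) w G S * (irregular dd sg s S)%:R <= b.
  move=> GGG.
  pose D v := [set e in G | v \in e].
  have DG v : D v \subset G by apply/subsetP => e; rewrite inE => /andP[].
  have cD v : #|D v| = dd v by rewrite -(graphs_with_vdeg v GGG).
  have cDS v (S : {set {set V}}) : S \subset G -> #|D v :\: S| = (dd v - vdeg S v)%N.
    move=> SG; rewrite -(residual_vdeg _ GGG SG) /vdeg; apply: eq_card => e.
    by rewrite !inE andbA.
  have bnd v x : `|x| = sg -> \sum_(S : {set {set V}} | (S \subset G) &&
        ((x + 3 * x ^+ 2) * ((1 - s) * #|D v|%:R) <= x * #|D v :\: S|%:R)) w G S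
      <= expR (- (sg ^+ 2 * ((1 - s) * delta))).
    move=> xsg; have x2 : x <= 1 / 2 by have := ler_norm x; lra.
    apply: le_trans (thin_tail (DG v) s01 x2) _; rewrite ler_expR lerN2.
    rewrite -xsg real_normK ?num_real // ler_wpM2l ?sqr_ge0 // ler_wpM2l // cD.
    exact: dlt.
  apply: le_trans (_ : \sum_v
      (\sum_(S : {set {set V}} | (S \subset G) &&
        ((- sg + 3 * (- sg) ^+ 2) * ((1 - s) * #|D v|%:R) <= - sg * #|D v :\: S|%:R))
        w G S
      + \sum_(S : {set {set V}} | (S \subset G) &&
        ((sg + 3 * sg ^+ 2) * ((1 - s) * #|D v|%:R) <= sg * #|D v :\: S|%:R))
        w G S) <= _); last first.
    apply: le_trans (_ : \sum_(v : V) 2 * expR (- (sg ^+ 2 * ((1 - s) * delta))) <= _).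
      apply: ler_sum => v _.
      have h1 : `|- sg| = sg by rewrite normrN gtr0_norm.
      have h2 : `|sg| = sg by rewrite gtr0_norm.
      by have := bnd v _ h1; have := bnd v _ h2; lra.
    by rewrite sumr_const -[_ *+ #|V|]mulr_natr /b mulrAC.
  under [X in _ <= X]eq_bigr => v _ do rewrite !big_mkcondr -big_split /=.
  rewrite exchange_big /=; apply: ler_sum => S SG.
  have terms0 v : 0 <= (if (- sg + 3 * (- sg) ^+ 2) * ((1 - s) * #|D v|%:R)
      <= - sg * #|D v :\: S|%:R then w G S else 0)
    + (if (sg + 3 * sg ^+ 2) * ((1 - s) * #|D v|%:R) <= sg * #|D v :\: S|%:R
       then w G S else 0).
    by apply: addr_ge0; case: ifP.
  case: (boolP (irregular dd sg s S)) => [/existsP[v Hv]|_]; last first.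
    by rewrite mulr0; apply: sumr_ge0.
  rewrite mulr1 (bigD1 v) //=; apply: ler_wpDr; first by apply: sumr_ge0.
  rewrite !cD !(cDS _ _ SG).
  case/orP: Hv => Hv.
    have -> : (- sg + 3 * (- sg) ^+ 2) * ((1 - s) * (dd v)%:R)
      <= - sg * (dd v - vdeg S v)%:R by nra.
    by rewrite lerDl; case: ifP.
  have -> : (sg + 3 * sg ^+ 2) * ((1 - s) * (dd v)%:R)
      <= sg * (dd v - vdeg S v)%:R by nra.
  by rewrite lerDr; case: ifP.
rewrite big_mkcond /=.
have -> : \sum_S (if irregular dd sg s S then thin GG m s S else 0) =
   \sum_S thin GG m s S * (irregular dd sg s S)%:R.
  by apply: eq_bigr => S _; case: ifP; rewrite ?mulr1 ?mulr0.
rewrite (thin_sum _ _ szG).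
have [G0|GG0] := posnP #|GG|; first by rewrite G0 invr0 mulr0.
rewrite ler_pdivrMr ?ltr0n // mulr_natr -sumr_const.
by apply: ler_sum => G GGG; apply: inner.
Qed.

(** Markov's inequality: averaged over S, the conditional probability of being
    crowded is the unconditional one. *)
Lemma thin_overcrowded (R : realType) (V : finType) (dd : V -> nat) (m k : nat)
    (beta s : R) :
    (forall G, G \in graphs_with dd -> #|G| = m) -> 0 < beta -> 0 <= s <= 1 ->
    (0 < #|graphs_with dd|)%N ->
  \sum_(S | overcrowded dd k beta S) thin (graphs_with dd) m s S
  <= #|crowded dd k|%:R / (beta * #|graphs_with dd|%:R).
Proof.
move=> szG b0 s01 GG0; set GG := graphs_with dd in szG GG0 *; set B := crowded dd k.
have szB G : G \in B -> #|G| = m by rewrite inE => /andP[/szG].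
have [B0|Bp] := posnP #|B|.
  rewrite B0 mul0r big1 // => S; rewrite /overcrowded.
  have -> : supersets (crowded dd k) S = finset.set0.
    apply/eqP; rewrite -finset.subset0 -(cards0_eq B0); apply/subsetP => G.
    by rewrite /supersets in_set => /andP[].
  by rewrite cards0 ltNge mulr_ge0 // ltW.
have GGr : 0 < #|GG|%:R :> R by rewrite ltr0n.
have Br : 0 < #|B|%:R :> R by rewrite ltr0n.
set b := _ / _; have -> : b = \sum_S thin B m s S * b.
  by rewrite -mulr_suml (thin_sum1 s szB Bp) mul1r.
rewrite big_mkcond /=; apply: ler_sum => S _.
have t0 := thin_ge0 B m S s01.
case: ifP => [H|_]; last first.
  by rewrite mulr_ge0 // divr_ge0 // mulr_ge0 // ltW.
rewrite /b /thin -!mulrA; have /andP[s0 s1] := s01.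
rewrite ler_wpM2l ?exprn_ge0 // ler_wpM2l ?exprn_ge0 ?subr_ge0 //.
have -> : #|supersets B S|%:R * (#|B|%:R^-1 * (#|B|%:R / (beta * #|GG|%:R)))
   = (#|supersets B S|%:R / beta) / #|GG|%:R :> R.
  by field; rewrite !gt_eqF.
rewrite ler_pM2r ?invr_gt0 // ler_pdivlMr // mulrC; exact: ltW.
Qed.

(** With q = 1 - s, switching_lower says that the fraction of graphs above S
    that contain e is at least r u * r v minus an error, divided by
    \sum_w r w + r u * r v.  Regularity makes these terms (q d)^2 and q d n up to
    factors 1 + O(sg), and the error is at most sg (q d)^2. *)
Lemma good_extension (R : realType) (V : finType) (dd : V -> nat) (D k : nat)
    (d sg s beta : R) (S : {set {set V}}) (e : {set V}) :
    0 < sg <= 1 / 100 -> 0 <= s -> s < 1 -> 0 < d ->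
    (forall v, (1 - sg) * d <= (dd v)%:R <= (1 + sg) * d) ->
    (forall v, (dd v <= D)%N) -> D%:R <= 2 * d -> 2 * d <= sg * #|V|%:R ->
    D%:R + k%:R + D%:R ^+ 2 * beta <= sg * ((1 - s) * d) ^+ 2 ->
    ~~ irregular dd sg s S -> ~~ overcrowded dd k beta S ->
    #|e| == 2%N -> e \notin S ->
  (1 - 16 * sg) * (d / #|V|%:R) * (1 - s) * #|supersets (graphs_with dd) S|%:R
  <= #|supersets (graphs_with dd) (e |: S)|%:R.
Proof.
move=> /andP[sg0 sg1] s0 s1 d0 ddd dD D2 dn small reg ncr /cards2P[u [v [uv ->]]] uvS.
have := switching_lower k dD uv uvS.
set c := #|supersets (graphs_with dd) S|; set c1 := #|supersets _ (_ |: S)|.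
set cB := #|supersets _ S|; set M := (\sum_w _)%N.
set ru := (dd u - vdeg S u)%N; set rv := (dd v - vdeg S v)%N => low.
have n0 : 0 < #|V|%:R :> R by have : 0 < sg * #|V|%:R by [lra]; rewrite pmulr_rgt0.
set n : R := #|V|%:R in dn n0 *; set q := 1 - s in small *.
have q0 : 0 < q by rewrite subr_gt0.
have regw w : (1 - 4 * sg) * (q * d) <= (dd w - vdeg S w)%:R <= (1 + 5 * sg) * (q * d).
  move: reg; rewrite negb_exists => /forallP /(_ w); rewrite negb_or -!ltNge -/q.
  move=> /andP[H1 H2]; have /andP[h1 h2] := ddd w.
  have a1 := ler_wpM2l (ltW q0) h1; have a2 := ler_wpM2l (ltW q0) h2.
  have qd : 0 < q * d by rewrite mulr_gt0.
  apply/andP; split.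
    apply: le_trans (ltW H1).
    apply: le_trans (_ : (1 - 3 * sg) * (q * ((1 - sg) * d)) <= _).
      have -> : (1 - 3 * sg) * (q * ((1 - sg) * d)) =
        (1 - 4 * sg) * (q * d) + 3 * sg ^+ 2 * (q * d) by ring.
      by rewrite lerDl mulr_ge0 ?(ltW qd) // mulr_ge0 ?sqr_ge0.
    by apply: ler_wpM2l => //; lra.
  apply: le_trans (ltW H2) _.
  apply: le_trans (_ : (1 + 3 * sg) * (q * ((1 + sg) * d)) <= _).
    by apply: ler_wpM2l => //; lra.
  have -> : (1 + 3 * sg) * (q * ((1 + sg) * d)) =
     (1 + 5 * sg) * (q * d) - sg * (1 - 3 * sg) * (q * d) by ring.
  by rewrite lerBlDr lerDl mulr_ge0 ?(ltW qd) // mulr_ge0; lra.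
have qd0 : 0 < q * d by rewrite mulr_gt0.
have ruv : (1 - 8 * sg) * (q * d) ^+ 2 <= ru%:R * rv%:R.
  have /andP[hu _] := regw u; have /andP[hv _] := regw v.
  apply: le_trans (_ : ((1 - 4 * sg) * (q * d)) * ((1 - 4 * sg) * (q * d)) <= _).
    have -> : (1 - 4 * sg) * (q * d) * ((1 - 4 * sg) * (q * d)) =
      (1 - 8 * sg) * (q * d) ^+ 2 + 16 * sg ^+ 2 * (q * d) ^+ 2 by ring.
    by rewrite lerDl mulr_ge0 ?sqr_ge0 // mulr_ge0 ?sqr_ge0.
  by apply: ler_pM => //; rewrite mulr_ge0 ?(ltW qd0) //; lra.
have Mle : M%:R + ru%:R * rv%:R <= (1 + 7 * sg) * (q * d) * n.
  have h1 : M%:R <= n * ((1 + 5 * sg) * (q * d)).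
    rewrite /M natr_sum /n mulr_natl -sumr_const; apply: ler_sum => w _.
    by have /andP[] := regw w.
  have h2 : ru%:R * rv%:R <= (1 + 5 * sg) * (q * d) * (sg * n).
    apply: ler_pM => //; first by have /andP[] := regw u.
    apply: le_trans dn; apply: le_trans D2; rewrite ler_nat.
    exact: leq_trans (leq_subr _ _) (dD v).
  have : 0 <= (q * d) * n * (sg * (1 - 5 * sg)).
    by rewrite !mulr_ge0 ?(ltW q0) ?(ltW d0) ?(ltW n0) ?(ltW sg0) //; lra.
  nra.
have {}low : c%:R * (ru%:R * rv%:R) <= c1%:R * (M%:R + ru%:R * rv%:R)
    + c%:R * (D%:R + k%:R) + D%:R ^+ 2 * cB%:R :> R.
  by rewrite -!(natrM, natrD, natrX) ler_nat.
have hB : cB%:R <= beta * c%:R by move: ncr; rewrite /overcrowded -leNgt.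
have hB' := ler_wpM2l (sqr_ge0 D%:R) hB.
have c0 : 0 <= c%:R :> R by [].
have hs := ler_wpM2l c0 small.
have hr := ler_wpM2l c0 ruv.
have hM : c1%:R * (M%:R + ru%:R * rv%:R) <= c1%:R * ((1 + 7 * sg) * (q * d) * n).
  by apply: ler_wpM2l.
have key : c%:R * ((1 - 9 * sg) * (q * d) ^+ 2) <= c1%:R * ((1 + 7 * sg) * (q * d) * n).
  lra.
have key2 : c%:R * ((1 - 9 * sg) * (q * d)) <= c1%:R * (1 + 7 * sg) * n.
  by rewrite -(ler_pM2r qd0); lra.
have -> : (1 - 16 * sg) * (d / n) * q * c%:R = (1 - 16 * sg) * (q * d) * c%:R / n.
  by field; rewrite gt_eqF.
rewrite ler_pdivrMr // -(@ler_pM2l _ (1 + 7 * sg)); last by lra.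
have : 0 <= c%:R * (q * d) * (112 * sg ^+ 2).
  by rewrite mulr_ge0 ?(mulr_ge0 c0 (ltW qd0)) // mulr_ge0 ?sqr_ge0.
lra.
Qed.

(** * Embedding at a fixed precision *)

(** Here A is at least n d / 2 in crowded_le, so that D^2 / A <= 8 d / n, and
    the h-th power of this is at most exp (- 10 d^2).  The number of choices in
    the union bound is at most exp (8 d^2), since log n <= d and D <= 2 d. *)
Lemma crowded_proportion (R : realType) (V : finType) (dd : V -> nat)
    (D m h : nat) (d L : R) :
    (forall v, (dd v <= D)%N) -> (\sum_v dd v = 2 * m)%N ->
    (0 < #|graphs_with dd|)%N -> (0 < #|V|)%N ->
    1 <= d -> D%:R <= 2 * d -> 96 * d <= #|V|%:R ->
    (forall v, 3 / 4 * d <= (dd v)%:R) ->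
    8 * d / #|V|%:R <= expR (- L) -> 10 * d ^+ 2 <= L * h%:R ->
    ln #|V|%:R <= d ->
  #|crowded dd (2 * h)|%:R <= expR (- (2 * d ^+ 2)) * #|graphs_with dd|%:R.
Proof.
move=> dD dm GG0 V0 d1 D2 dn dlow HL Hh Hln.
set n := #|V| in V0 dn HL Hln *.
have n0 : 0 < n%:R :> R by rewrite ltr0n.
have d0 : 0 < d by lra.
pose A := (2 * m - 2 * D ^ 2 - 2 * (D.+1 * D))%N.
have DD : (D ^ 2)%:R <= 4 * d ^+ 2 :> R.
  rewrite natrX; apply: le_trans (_ : (2 * d) ^+ 2 <= _); last by rewrite exprMn; lra.
  by rewrite lerXn2r ?nnegrE // ?mulr_ge0 // ltW.
have dd2 : d <= d ^+ 2 by rewrite expr2 ler_peMr // ltW.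
have low : (2 * D ^ 2 + 2 * (D.+1 * D))%:R <= 20 * d ^+ 2 :> R.
  have -> : (2 * D ^ 2 + 2 * (D.+1 * D) = 4 * D ^ 2 + 2 * D)%N by rewrite -mulnn; ring.
  by rewrite natrD !natrM; lra.
have dn2 : 96 * d ^+ 2 <= n%:R * d by rewrite expr2 mulrA ler_wpM2r // ltW.
have mlow : 3 / 4 * d * n%:R <= (2 * m)%:R :> R.
  rewrite -dm natr_sum /n mulr_natr -sumr_const; apply: ler_sum => v _; exact: dlow.
have Alow : n%:R * d / 2 <= A%:R :> R.
  have H : (2 * D ^ 2 + 2 * (D.+1 * D) <= 2 * m)%N by rewrite -(ler_nat R); lra.
  by rewrite /A -subnDA natrB //; lra.
have A0 : (0 < A)%N.
  rewrite -(ltr0n R); apply: lt_le_trans Alow; by rewrite divr_gt0 // mulr_gt0.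
have DA : (D ^ 2 <= A)%N by rewrite -(ler_nat R); lra.
have := @crowded_le V dd D m A (2 * h) h dD dm (leqnn _) DA A0 (leqnSn _).
rewrite -(ler_nat R) !natrM !natrX -/n => H.
have Ar : 0 < A%:R :> R by rewrite ltr0n.
have Ah : 0 < A%:R ^+ h :> R by rewrite exprn_gt0.
rewrite -(ler_pM2r Ah); apply: le_trans H _.
set g : R := #|graphs_with dd|%:R; have g0 : 0 <= g by [].
have e1 : n%:R ^+ D <= expR (2 * d ^+ 2) :> R.
  rewrite -[n%:R]lnK ?posrE // -expRM_natr ler_expR.
  have ln0 : 0 <= ln n%:R :> R by rewrite ln_ge0 // ler1n.
  by have := ler_pM ln0 (ler0n R D) Hln D2; lra.
have e2 : 2 ^+ (D ^ 2)%N <= expR (4 * d ^+ 2) :> R.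
  apply: le_trans (_ : expR 1 ^+ (D ^ 2)%N <= _).
    by rewrite lerXn2r ?nnegrE ?expR_ge0 //; have := expR_ge1Dx (1 : R); lra.
  by rewrite -expRM_natr mul1r ler_expR.
have e3 : (D%:R ^+ 2) ^+ h <= expR (- (10 * d ^+ 2)) * A%:R ^+ h :> R.
  have step : D%:R ^+ 2 <= expR (- L) * A%:R :> R.
    apply: le_trans (_ : 8 * d / n%:R * A%:R <= _); last by rewrite ler_wpM2r // ltW.
    apply: le_trans (_ : 8 * d / n%:R * (n%:R * d / 2) <= _); last first.
      by rewrite ler_wpM2l // divr_ge0 // mulr_ge0 // ltW.
    have -> : 8 * d / n%:R * (n%:R * d / 2) = 4 * d ^+ 2 by field; rewrite gt_eqF.
    by rewrite -natrX.
  apply: le_trans (_ : (expR (- L) * A%:R) ^+ h <= _).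
    by rewrite lerXn2r ?nnegrE ?sqr_ge0 // mulr_ge0 ?expR_ge0.
  by rewrite exprMn ler_wpM2r ?(ltW Ah) // -expRM_natr ler_expR; lra.
apply: le_trans (_ : (expR (2 * d ^+ 2) * expR (2 * d ^+ 2) * expR (4 * d ^+ 2))
   * (g * (expR (- (10 * d ^+ 2)) * A%:R ^+ h)) <= _).
  apply: ler_pM; first by rewrite !mulr_ge0 ?exprn_ge0.
  - by rewrite mulr_ge0 ?exprn_ge0 // mulr_ge0.
  - apply: ler_pM => //; rewrite ?mulr_ge0 ?exprn_ge0 //.
    by apply: ler_pM => //; rewrite exprn_ge0.
  - by rewrite ler_wpM2l.
have -> : expR (- (2 * d ^+ 2)) = expR (2 * d ^+ 2) * expR (2 * d ^+ 2)
     * expR (4 * d ^+ 2) * expR (- (10 * d ^+ 2)).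
  by rewrite -!expRD; congr expR; ring.
by rewrite le_eqVlt; apply/orP; left; apply/eqP; ring.
Qed.

Definition pairs (V : finType) : {set {set V}} := [set e : {set V} | #|e| == 2%N].

Lemma card_pairs_le (V : finType) : (#|pairs V| <= #|V| ^ 2)%N.
Proof.
rewrite -mulnn -card_prod.
apply: leq_trans (leq_imset_card (fun q : V * V => [set q.1; q.2]) (pred_of_simpl predT)).
apply/subset_leq_card/subsetP => e; rewrite inE => /cards2P[x [y [_ ->]]].
by apply/imsetP; exists (x, y).
Qed.

(** The lower bound follows from (1 - x) ^ k (1 + k x) <= 1. *)
Lemma one_minus_expn (R : realFieldType) (x : R) (k : nat) : 0 <= x <= 1 ->
  k%:R * x - (k%:R * x) ^+ 2 <= 1 - (1 - x) ^+ k <= k%:R * x.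
Proof.
move=> x01; have /andP[x0 x1] := x01; have B := bernoulli_le k x01.
apply/andP; split; last by lra.
have /andP[_ U] := binomial_le1 k x01.
have y0 : 0 <= k%:R * x by rewrite mulr_ge0.
have p0 : 0 <= (1 - x) ^+ k by rewrite exprn_ge0 // subr_ge0.
have p1 : (1 - x) ^+ k <= (1 - x) ^+ k.-1.
  by case: k {B U y0 p0} => // k; rewrite exprS ler_piMl ?exprn_ge0 ?subr_ge0 //; lra.
have : (1 - x) ^+ k * (1 + k%:R * x) <= 1.
  have := ler_wpM2l y0 p1; lra.
nra.
Qed.

Lemma small_cube (R : realFieldType) (a : R) : 0 < a <= 1 / 100 ->
  [/\ 0 < a ^+ 3, a ^+ 3 <= a / 100 & 10 <= (a ^+ 3)^-1].
Proof.
move=> /andP[a0 a1]; have a30 : 0 < a ^+ 3 by rewrite exprn_gt0.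
have a2 : a ^+ 2 <= (1 / 100) ^+ 2 by rewrite lerXn2r ?nnegrE ?(ltW a0) ?divr_ge0.
have a3 : a ^+ 3 <= a / 100.
  by rewrite exprS; have := ler_wpM2l (ltW a0) a2; clear - a0; lra.
split; [exact: a30 | exact: a3 |].
rewrite -(ler_pM2r a30) mulVf; last by rewrite gt_eqF.
have h : 10 * a ^+ 3 <= 10 * (a / 100) by rewrite ler_wpM2l.
by apply: le_trans h _; clear - a1; lra.
Qed.

(** The hypothesis with the exponential makes d / n very small, since
    exp (- y) y <= 1. *)
Lemma density_bounds (R : realType) (a d n : R) :
    0 < a <= 1 / 100 -> 0 < n -> 8 / a ^+ 3 <= d ->
    8 * d / n <= expR (- (80 / a ^+ 3)) ->
  [/\ 80 <= d, 8 <= a ^+ 3 * d, 0 < d / n <= a / 640 & 640 * d <= a * n].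
Proof.
move=> a01 n0 hd hdn; have [a30 a3a K6] := small_cube a01.
have /andP[a0 a1] := a01.
set K := (a ^+ 3)^-1 in hd hdn K6.
have Ka : K * a ^+ 3 = 1 by rewrite mulVf // gt_eqF.
have d8 : 80 <= d by clear - hd K6; lra.
have d0 : 0 < d by clear - d8; lra.
have t0 : 0 < d / n by rewrite divr_gt0.
have ad : 8 <= a ^+ 3 * d.
  by rewrite mulrC -ler_pdivrMr.
have e0 := expR_gt0 (- (80 * K)).
have dna : d / n <= a / 640.
  have e := expR_ge1Dx (80 * K).
  have ee : expR (- (80 * K)) * expR (80 * K) = 1 by rewrite -expRD addNr expR0.
  have K0 : 0 < K by rewrite invr_gt0.
  have h1 : expR (- (80 * K)) * (80 * K) <= 1.
    have := ler_wpM2l (ltW e0) e; rewrite ee mulrDr mulr1; clear - e0; lra.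
  have h2 : 8 * (d / n) * (80 * K) <= 1.
    apply: le_trans h1; rewrite ler_wpM2r ?mulr_ge0 ?(ltW K0) //.
    by rewrite mulrA.
  have h3 := ler_wpM2r (ltW a30) h2.
  have h4 : 8 * (d / n) * (80 * K) * a ^+ 3 = 640 * (d / n).
    have -> : 8 * (d / n) * (80 * K) * a ^+ 3 = 640 * (d / n) * (K * a ^+ 3) by ring.
    by rewrite Ka mulr1.
  rewrite h4 in h3; clear - h3 a3a a0; lra.
split=> //; first by rewrite t0.
have := ler_wpM2r (ltW n0) dna; rewrite divfK ?gt_eqF //.
by clear; lra.
Qed.

(** The value of h is about a^3 d^2 / 8: small enough that 2 h walks are within
    the error allowed in good_extension, and large enough that
    (80 / a^3) h >= 10 d^2. *)
Lemma crowded_rare (R : realType) (V : finType) (dd : V -> nat) (D m : nat) (a d : R) :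
    0 < a <= 1 / 100 -> (0 < #|V|)%N -> (0 < #|graphs_with dd|)%N ->
    8 / a ^+ 3 <= d -> 8 / a ^+ 3 * ln #|V|%:R <= d ->
    8 * d / #|V|%:R <= expR (- (80 / a ^+ 3)) ->
    (forall v, (dd v <= D)%N) -> D%:R <= 2 * d -> (\sum_v dd v = 2 * m)%N ->
    (forall v, (1 - a) * d <= (dd v)%:R) ->
  exists2 h : nat, h%:R <= a ^+ 3 * d ^+ 2 / 4
    & #|crowded dd (2 * h)|%:R <= expR (- (2 * d ^+ 2)) * #|graphs_with dd|%:R.
Proof.
move=> a01 V0 GG0 hd hln hdn dD D2 dm dlow.
have n0 : 0 < #|V|%:R :> R by rewrite ltr0n.
have [d8 ad /andP[t0 ta] dna] := density_bounds a01 n0 hd hdn.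
have [a30 a3a K6] := small_cube a01; have /andP[a0 a1] := a01.
have d0 : 0 < d by clear - d8; lra.
have ln0 : 0 <= ln #|V|%:R :> R by rewrite ln_ge0 // ler1n.
pose h := (Num.truncn (a ^+ 3 * d ^+ 2 / 8)).+1.
have add : 8 * d <= a ^+ 3 * d ^+ 2 by rewrite expr2 mulrA ler_wpM2r // ltW.
have add0 : 0 <= a ^+ 3 * d ^+ 2 / 8 by rewrite divr_ge0 // mulr_ge0 ?sqr_ge0 // ltW.
have /andP[h1 h2] := truncn_itv add0; rewrite -/h in h2.
exists h.
  by rewrite /h -natr1; clear - h1 add d8; lra.
apply: (@crowded_proportion _ _ _ D m h d (80 / a ^+ 3)) => //.
- by clear - d8; lra.
- apply: le_trans (_ : 640 * d <= _); first by clear - d0; lra.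
  apply: le_trans dna _; rewrite ler_piMl ?(ltW n0) //; clear - a1; lra.
- move=> v; apply: le_trans (dlow v); rewrite ler_wpM2r ?(ltW d0) //; clear - a1; lra.
- have K0 : 0 < (a ^+ 3)^-1 by rewrite invr_gt0.
  have := ler_wpM2l (ltW K0) (ltW h2).
  have -> : (a ^+ 3)^-1 * (a ^+ 3 * d ^+ 2 / 8) = d ^+ 2 / 8.
    by field; rewrite gt_eqF.
  by clear; lra.
- apply: le_trans hln; rewrite ler_peMl //; clear - K6; lra.
Qed.

(** Both kinds of bad states have probability O(n^(- 6)), which is summable
    over n^5 steps. *)
Lemma bad_mass (R : realType) (V : finType) (dd : V -> nat) (m k : nat)
    (a d s : R) :
    0 < a <= 1 / 100 -> (0 < #|V|)%N -> (0 < #|graphs_with dd|)%N ->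
    (forall G, G \in graphs_with dd -> #|G| = m) ->
    80 <= d -> 8 / a ^+ 3 * ln #|V|%:R <= d ->
    (forall v, (1 - a) * d <= (dd v)%:R) -> 0 <= s <= 1 - a ->
    #|crowded dd k|%:R <= expR (- (2 * d ^+ 2)) * #|graphs_with dd|%:R ->
  \sum_(S | irregular dd a s S || overcrowded dd k (a ^+ 3 / 16) S)
     thin (graphs_with dd) m s S
  <= 2 * #|V|%:R * expR (- (7 * ln #|V|%:R))
     + expR (- (7 * ln #|V|%:R)) * (16 / a ^+ 3).
Proof.
move=> a01 V0 GG0 szG d8 hln dlow /andP[s0 s1] Hcr.
have [a30 a3a K6] := small_cube a01; have /andP[a0 a1] := a01.
have s01 : 0 <= s <= 1 by rewrite s0 /=; clear - s1 a0; lra.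
have d0 : 0 < d by clear - d8; lra.
have ln0 : 0 <= ln #|V|%:R :> R by rewrite ln_ge0 // ler1n.
have lnd : 8 * ln #|V|%:R <= a ^+ 3 * d.
  have -> : 8 * ln #|V|%:R = a ^+ 3 * (8 / a ^+ 3 * ln #|V|%:R).
    by field; rewrite gt_eqF.
  by rewrite ler_wpM2l // ltW.
set GG := graphs_with dd in GG0 szG Hcr *.
set beta := a ^+ 3 / 16; have beta0 : 0 < beta by rewrite divr_gt0.
apply: le_trans (_ : \sum_(S | irregular dd a s S) thin GG m s S
    + \sum_(S | overcrowded dd k beta S) thin GG m s S <= _).
  rewrite big_mkcond [X in _ <= X + _]big_mkcond [X in _ <= _ + X]big_mkcond /=.
  rewrite -big_split /=; apply: ler_sum => S _.
  have t0 := thin_ge0 GG m S s01.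
  case: (irregular _ _ _ _); case: (overcrowded _ _ _ _); rewrite ?addr0 ?add0r //=.
  by rewrite lerDl.
apply: lerD.
  apply: le_trans (thin_irregular (delta := (1 - a) * d) szG _ s01 _) _ => //.
    by rewrite a0; clear - a1; lra.
  rewrite ler_wpM2l ?mulr_ge0 // ler_expR lerN2.
  apply: le_trans (_ : a ^+ 2 * (a * ((1 - a) * d)) <= _).
    have -> : a ^+ 2 * (a * ((1 - a) * d)) = a ^+ 3 * d - a * (a ^+ 3 * d) by ring.
    have a3d : 0 <= a ^+ 3 * d by rewrite mulr_ge0 ?ltW.
    have := ler_wpM2r a3d a1; clear - lnd ln0 a3d; lra.
  have da : 0 <= (1 - a) * d by rewrite mulr_ge0 ?(ltW d0) //; clear - a1; lra.
  rewrite ler_wpM2l ?sqr_ge0 // ler_wpM2r //; clear - s1; lra.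
apply: le_trans (thin_overcrowded _ szG beta0 s01 GG0) _.
have GGr : 0 < #|GG|%:R :> R by rewrite ltr0n.
rewrite ler_pdivrMr ?(mulr_gt0 beta0 GGr) //.
have -> : 16 / a ^+ 3 = beta^-1 by rewrite /beta invf_div.
have -> : expR (- (7 * ln #|V|%:R)) / beta * (beta * #|GG|%:R) =
    expR (- (7 * ln #|V|%:R)) * #|GG|%:R by rewrite mulrA divfK ?gt_eqF.
apply: le_trans Hcr _; rewrite ler_wpM2r ?(ltW GGr) // ler_expR lerN2.
have l7 : 7 * ln #|V|%:R <= d.
  have : a ^+ 3 * d <= d by rewrite ler_piMl ?(ltW d0) //; clear - a3a a1; lra.
  by clear - lnd ln0; lra.
apply: le_trans l7 _; apply: le_trans (_ : d ^+ 2 <= _).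
  by rewrite expr2 ler_peMl ?(ltW d0) //; clear - d8; lra.
by have := sqr_ge0 d; clear; lra.
Qed.

Lemma good_density (R : realType) (V : finType) (dd : V -> nat) (D h : nat)
    (a d s : R) (S : {set {set V}}) (e : {set V}) :
    0 < a <= 1 / 100 -> 0 <= s <= 1 - a -> 80 <= d -> 8 <= a ^+ 3 * d ->
    640 * d <= a * #|V|%:R ->
    (forall v, (1 - a) * d <= (dd v)%:R <= (1 + a) * d) ->
    (forall v, (dd v <= D)%N) -> D%:R <= 2 * d -> h%:R <= a ^+ 3 * d ^+ 2 / 4 ->
    ~~ (irregular dd a s S || overcrowded dd (2 * h) (a ^+ 3 / 16) S) ->
    e \in pairs V -> e \notin S ->
  (1 - 16 * a) * (d / #|V|%:R) * (1 - s) * #|supersets (graphs_with dd) S|%:R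
  <= #|supersets (graphs_with dd) (e |: S)|%:R.
Proof.
move=> a01 /andP[s0 s1] d8 ad dna ddd dD D2 hh; rewrite negb_or => /andP[Hi Ho].
have /andP[a0 a1] := a01; have d0 : 0 < d by clear - d8; lra.
rewrite inE => e2 eS.
apply: (good_extension (D := D) (beta := a ^+ 3 / 16) (k := (2 * h)%N)) => //.
- by clear - s1 a0; lra.
- apply: le_trans dna; clear - d0; lra.
have q2 : a ^+ 2 <= (1 - s) ^+ 2.
  by rewrite lerXn2r ?nnegrE //; clear - s1 a0; lra.
have D22 : D%:R ^+ 2 <= 4 * d ^+ 2 :> R.
  apply: le_trans (_ : (2 * d) ^+ 2 <= _); last by rewrite exprMn; clear; lra.
  by rewrite lerXn2r ?nnegrE // ?mulr_ge0 // ltW.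
have H1 : D%:R ^+ 2 * (a ^+ 3 / 16) <= 4 * d ^+ 2 * (a ^+ 3 / 16).
  by rewrite ler_wpM2r // divr_ge0 // exprn_ge0 // ltW.
have H2 : a ^+ 3 * d ^+ 2 <= a * ((1 - s) * d) ^+ 2.
  have := ler_wpM2l (ltW a0) (ler_wpM2r (sqr_ge0 d) q2).
  by rewrite mulrA -exprS exprMn.
have H3 : 8 * d <= a ^+ 3 * d ^+ 2 by rewrite expr2 mulrA ler_wpM2r // ltW.
by rewrite natrM; clear - H1 H2 H3 D2 hh d8; lra.
Qed.

Lemma step_sizes (R : realFieldType) (a n N m tau : R) (x := m * tau / a) :
    0 < a <= 1 / 100 -> 1 <= n -> 20 <= a ^+ 4 * n ->
    tau = (1 - a) / n ^+ 5 -> 0 <= N <= n ^+ 2 -> 0 <= m <= n ^+ 2 ->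
  [/\ 0 <= tau <= n^-1 ^+ 5, 0 <= N * tau <= n^-1 ^+ 3, 0 <= x <= n^-1 ^+ 3 / a,
      x <= a & x + x ^+ 2 + N * tau <= 1].
Proof.
move=> a01 n1 hn tauE /andP[N0 Nn] /andP[m0 mn].
have [a30 a3a K6] := small_cube a01; have /andP[a0 a1] := a01.
have n0 : 0 < n by clear - n1; lra.
set i := n^-1; have i0 : 0 < i by rewrite invr_gt0.
have ni : n * i = 1 by rewrite mulfV // gt_eqF.
have i1 : i <= 1 by rewrite invf_le1.
have tau0 : 0 <= tau.
  by rewrite tauE divr_ge0 ?exprn_ge0 ?(ltW n0) //; clear - a1; lra.
have tau_le : tau <= i ^+ 5.
  rewrite tauE /i exprVn ler_piMl ?invr_ge0 ?exprn_ge0 ?(ltW n0) //.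
  by clear - a0; lra.
have n2tau : n ^+ 2 * tau <= i ^+ 3.
  have -> : i ^+ 3 = n ^+ 2 * i ^+ 5.
    have -> : n ^+ 2 * i ^+ 5 = (n * i) ^+ 2 * i ^+ 3 by ring.
    by rewrite ni expr1n mul1r.
  by rewrite ler_wpM2l // exprn_ge0 // ltW.
have Ntau : N * tau <= i ^+ 3 by apply: le_trans n2tau; rewrite ler_wpM2r.
have mtau : m * tau <= i ^+ 3 by apply: le_trans n2tau; rewrite ler_wpM2r.
have ia : 20 * i <= a ^+ 4.
  by have := ler_wpM2r (ltW i0) hn; rewrite -(mulrA (a ^+ 4)) ni mulr1.
have i3 : i ^+ 3 <= i.
  by rewrite exprS ler_piMr ?(ltW i0) // exprn_ile1 // ltW.
have a2 : a ^+ 2 <= 1 by rewrite exprn_ile1 ?(ltW a0) //; clear - a1; lra.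
have a4 : a ^+ 4 <= a ^+ 2.
  by rewrite -[4%N]/(2 + 2)%N exprD ler_piMl ?sqr_ge0.
have x0 : 0 <= x by rewrite /x divr_ge0 ?mulr_ge0 ?(ltW a0).
have xi : x <= i ^+ 3 / a by rewrite /x ler_wpM2r ?invr_ge0 ?(ltW a0).
have xa : x <= a / 20.
  apply: le_trans xi _; rewrite ler_pdivrMr //.
  have -> : a / 20 * a = a ^+ 2 / 20 by ring.
  by clear - i3 ia a4; lra.
have x2 : x ^+ 2 <= x.
  by rewrite expr2 ler_piMr //; clear - xa a1; lra.
split.
- by rewrite tau0.
- by rewrite mulr_ge0.
- by rewrite x0.
- by clear - xa a0; lra.
- by clear - xa x2 Ntau i3 ia a4 a2 a1; lra.
Qed.

(** Each of the n^5 steps loses O(n^(- 6)), with a constant depending on a. *)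
Lemma total_loss (R : realFieldType) (a n y x b : R) :
    0 < a <= 1 / 100 -> 1 <= n -> 20 <= a ^+ 4 * n ->
    0 <= y <= n^-1 ^+ 3 -> 0 <= x <= n^-1 ^+ 3 / a ->
    b <= 2 * n * n^-1 ^+ 7 + n^-1 ^+ 7 * (16 / a ^+ 3) ->
  n ^+ 5 * (x ^+ 2 + y ^+ 2 + b) <= a.
Proof.
move=> a01 n1 hn /andP[y0 yi] /andP[x0 xi] hb.
have [a30 a3a K6] := small_cube a01; have /andP[a0 a1] := a01.
have n0 : 0 < n by clear - n1; lra.
have n50 : 0 <= n ^+ 5 by rewrite exprn_ge0 // ltW.
set i := n^-1 in yi xi hb; have i0 : 0 < i by rewrite invr_gt0.
set K := (a ^+ 3)^-1 in hb K6.
have Ka : K * a ^+ 3 = 1 by rewrite mulVf // gt_eqF.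
have K0 : 0 < K by rewrite invr_gt0.
have ni : n * i = 1 by rewrite mulfV // gt_eqF.
have i1 : i <= 1 by rewrite invf_le1.
have Ji : n ^+ 5 * i ^+ 5 = 1 by rewrite -exprMn ni expr1n.
have J6 : n ^+ 5 * i ^+ 6 = i by rewrite (exprSr i) mulrA Ji mul1r.
have i30 : 0 <= i ^+ 3 by rewrite exprn_ge0 // ltW.
have L1 : n ^+ 5 * y ^+ 2 <= i.
  rewrite -[X in _ <= X]J6 ler_wpM2l // -[6%N]/(3 * 2)%N exprM.
  by rewrite lerXn2r ?nnegrE.
have aK : (a ^+ 2)^-1 <= K.
  have a20 : 0 < a ^+ 2 by rewrite exprn_gt0.
  rewrite /K lef_pV2 ?posrE // exprS ler_piMl ?(ltW a20) //.
  by clear - a1; lra.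
have L2 : n ^+ 5 * x ^+ 2 <= i * K.
  apply: le_trans (_ : i / a ^+ 2 <= _); last by rewrite ler_wpM2l // ltW.
  have -> : i / a ^+ 2 = n ^+ 5 * (i ^+ 3 / a) ^+ 2.
    by rewrite expr_div_n mulrA -exprM J6.
  by rewrite ler_wpM2l // lerXn2r ?nnegrE // divr_ge0 // ltW.
have L3 : n ^+ 5 * (2 * n * i ^+ 7) = 2 * i.
  have -> : n ^+ 5 * (2 * n * i ^+ 7) = 2 * i * (n * i) * (n ^+ 5 * i ^+ 5) by ring.
  by rewrite ni Ji !mulr1.
have L4 : n ^+ 5 * (i ^+ 7 * (16 * K)) <= 16 * (i * K).
  have -> : n ^+ 5 * (i ^+ 7 * (16 * K)) = 16 * (i * K) * (i * (n ^+ 5 * i ^+ 5)) by ring.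
  by rewrite Ji mulr1 ler_piMr // !mulr_ge0 // ltW.
have ia : 20 * i <= a ^+ 4.
  by have := ler_wpM2r (ltW i0) hn; rewrite -(mulrA (a ^+ 4)) ni mulr1.
have iK : 20 * (i * K) <= a.
  have := ler_wpM2r (ltW K0) ia.
  have -> : a ^+ 4 * K = a * (K * a ^+ 3) by ring.
  by rewrite Ka mulr1 mulrA.
have i_iK : 3 * i <= i * K.
  by rewrite [3 * i]mulrC ler_wpM2l ?(ltW i0) //; clear - K6; lra.
have := ler_wpM2l n50 hb; rewrite mulrDr L3 => hb'.
by rewrite !mulrDr; clear - L1 L2 L4 iK i_iK hb' i0; lra.
Qed.

(** Here y is the expected number of arrivals of a pair over all steps; the
    probability of at least one arrival, which is the density of the embedded
    graph, lies between y - y^2 and y. *)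
Lemma retention_bounds (R : realFieldType) (a t x y : R) :
    0 < a <= 1 / 100 -> 0 < t <= a -> 0 <= x <= a ->
    y = (1 - a) * (1 - x) * ((1 - 16 * a) * t) ->
  [/\ 0 <= y, y <= t & (1 - 20 * a) * t <= y - y ^+ 2].
Proof.
move=> /andP[a0 a1] /andP[t0 ta] /andP[x0 xa] yE.
have at0 : 0 <= a * t by rewrite mulr_ge0 // ltW.
have c0 : 0 <= (1 - a) * (1 - x) by rewrite mulr_ge0; clear - a1 xa; lra.
have c1 : (1 - a) * (1 - x) <= 1.
  by rewrite mulr_ile1 //; clear - a0 a1 x0 xa; lra.
have c2 : 1 - 2 * a <= (1 - a) * (1 - x).
  have : 0 <= a * x by rewrite mulr_ge0 // ltW.
  by clear - xa; lra.
have r0 : 0 <= (1 - 16 * a) * t by rewrite mulr_ge0 ?(ltW t0) //; clear - a1; lra.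
have y0 : 0 <= y by rewrite yE mulr_ge0.
have yt : y <= t.
  apply: le_trans (_ : (1 - 16 * a) * t <= _); first by rewrite yE ler_piMl.
  by clear - at0; lra.
split=> //.
have h1 : (1 - 2 * a) * ((1 - 16 * a) * t) <= y by rewrite yE ler_wpM2r.
have h2 : y ^+ 2 <= a * t by rewrite expr2 ler_pM //; apply: le_trans ta.
have h3 : 0 <= a * (a * t) by rewrite mulr_ge0 // ltW.
by clear - h1 h2 h3 at0; lra.
Qed.

(** The parameter a plays every small role at once: the exposure stops at time
    1 - a, the degrees deviate from d by a factor 1 + O(a), and the coupling
    fails with probability at most a. *)
Lemma finite_embedding (R : realType) (V : finType) (dd : V -> nat) (a d : R) :
    0 < a <= 1 / 100 -> (0 < #|V|)%N -> (0 < #|graphs_with dd|)%N ->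
    8 / a ^+ 3 <= d -> 8 / a ^+ 3 * ln #|V|%:R <= d ->
    8 * d / #|V|%:R <= expR (- (80 / a ^+ 3)) -> 20 <= a ^+ 4 * #|V|%:R ->
    (forall v, (1 - a) * d <= (dd v)%:R <= (1 + a) * d) ->
  exists p : R, [/\ (1 - 20 * a) * (d / #|V|%:R) <= p <= d / #|V|%:R, 0 <= p <= 1
    & embeds (thin [set pairs V] #|pairs V| p)
        (fun G => (G \in graphs_with dd)%:R / #|graphs_with dd|%:R) a].
Proof.
move=> a01 V0 GG0 hd hln hdn hn ddd.
have /andP[a0 a1] := a01.
set GG := graphs_with dd in GG0 *; set n : R := #|V|%:R in hln hdn hn *.
have n0 : 0 < n by rewrite ltr0n.
have n1 : 1 <= n by rewrite ler1n.
have [d8 ad /andP[t0 ta] dna] := density_bounds a01 n0 hd hdn.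
have d0 : 0 < d by clear - d8; lra.
pose D := \max_v dd v.
have dD v : (dd v <= D)%N by exact: (leq_bigmax v).
have D2 : D%:R <= 2 * d.
  have dd0 : 0 <= 2 * d by rewrite mulr_ge0 // ltW.
  rewrite -truncn_ge_nat //; apply/bigmax_leqP => v _; rewrite truncn_ge_nat //.
  have /andP[_ H] := ddd v; apply: le_trans H _; rewrite ler_wpM2r ?(ltW d0) //.
  by clear - a1; lra.
have dlow v : (1 - a) * d <= (dd v)%:R by have /andP[] := ddd v.
have [G0 G0G] : exists G, G \in GG by apply/card_gt0P.
pose m := #|G0|.
have dm : (\sum_v dd v = 2 * m)%N.
  rewrite -(handshake (graphs_with_graph G0G)); apply: eq_bigr => v _.
  by rewrite (graphs_with_vdeg v G0G).
have szG G : G \in GG -> #|G| = m.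
  move=> GGG; apply/eqP; rewrite -(eqn_pmul2l (isT : (0 < 2)%N)) -dm.
  rewrite -(handshake (graphs_with_graph GGG)); apply/eqP/eq_bigr => v _.
  by rewrite (graphs_with_vdeg v GGG).
have [h hh Hcr] := crowded_rare a01 V0 GG0 hd hln hdn dD D2 dm dlow.
(* J steps, where m and the number of pairs are at most n^2: two simultaneous
   arrivals have probability O(n^4 / J^2) per step, hence O(n^4 / J) in total. *)
pose J := (#|V| ^ 5)%N; have JE : J%:R = n ^+ 5 by rewrite /J natrX.
pose tau := (1 - a) / n ^+ 5.
pose x := m%:R * tau / a.
have mN : (m <= #|pairs V|)%N.
  apply/subset_leq_card/subsetP => e eG; rewrite inE.
  exact: (forall_inP (graphs_with_graph G0G) _ eG).
have Nn : 0 <= (#|pairs V|%:R : R) <= n ^+ 2.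
  by rewrite /n ler0n -natrX ler_nat card_pairs_le.
have mn : 0 <= (m%:R : R) <= n ^+ 2.
  by rewrite ler0n /=; have /andP[_] := Nn; apply: le_trans; rewrite ler_nat.
have [/andP[tau0 tau1] Ntau xi xa small] := step_sizes a01 n1 hn (erefl tau) Nn mn.
rewrite -/x in xi xa small.
have /andP[x0 _] := xi.
have Jtau : J%:R * tau = 1 - a.
  by rewrite JE /tau mulrC divfK // gt_eqF // exprn_gt0.
have jt j : (j < J)%N -> 0 <= j%:R * tau <= 1 - a.
  by move=> jJ; rewrite mulr_ge0 //= -Jtau ler_wpM2r // ler_nat ltnW.
pose bad (j : nat) S :=
  irregular dd a (j%:R * tau) S || overcrowded dd (2 * h) (a ^+ 3 / 16) S.
have Hb j (jJ : (j < J)%N) := bad_mass a01 V0 GG0 szG d8 hln dlow (jt j jJ) Hcr.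
have Hgood j S e : (j < J)%N -> ~~ bad j S -> supersets GG S != finset.set0 ->
    e \in pairs V -> e \notin S ->
    (1 - 16 * a) * (d / n) * (1 - j%:R * tau) * #|supersets GG S|%:R
      <= #|supersets GG (e |: S)|%:R.
  move=> jJ bS _.
  exact: (good_density (D := D) (h := h) a01 (jt j jJ) d8 ad dna ddd).
pose eta := tau * (1 - x) * ((1 - 16 * a) * (d / n)).
have JeE : J%:R * eta = (1 - a) * (1 - x) * ((1 - 16 * a) * (d / n)).
  by rewrite -Jtau /eta; clear; ring.
have t0a : 0 < d / n <= a by rewrite t0; clear - ta a0; lra.
have xa' : 0 <= x <= a by rewrite x0.
have [y0 yt ylow] := retention_bounds a01 t0a xa' JeE.
have rho01 : 0 <= (1 - 16 * a) * (d / n) <= 1.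
  have t1 : 0 <= a * (d / n) by rewrite mulr_ge0 // ltW.
  rewrite mulr_ge0 ?(ltW t0) //=; first by clear - t1 ta a1; lra.
  by clear - a1; lra.
have eta01 : 0 <= eta <= 1.
  have J1 : 1 <= J%:R :> R by rewrite ler1n expn_gt0 V0.
  have J0 : 0 < J%:R :> R by rewrite (lt_le_trans ltr01).
  have e0 : 0 <= eta by rewrite -(pmulr_rge0 _ J0).
  rewrite e0 /=; apply: le_trans (_ : J%:R * eta <= _); first by rewrite ler_peMl.
  by clear - yt ta a1; lra.
have /andP[E1 E2] := one_minus_expn J eta01.
exists (1 - (1 - eta) ^+ J); split.
- by rewrite (le_trans ylow E1) (le_trans E2 yt).
- apply/andP; split; last by rewrite (le_trans E2) // (le_trans yt) //; clear - ta a1; lra.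
  rewrite subr_ge0 exprn_ile1 // ?subr_ge0; have /andP[e0 e1] := eta01 => //.
  by clear - e0; lra.
apply: embeds_weaken (embeds_chain szG GG0 _ tau0 Jtau rho01 small Hb Hgood).
- rewrite JE; apply: (total_loss a01 n1 hn Ntau xi).
  have E7 : expR (- (7 * ln n)) = n^-1 ^+ 7.
    by rewrite -mulrN mulrC expRM_natr expRN lnK ?posrE.
  by rewrite E7.
- by rewrite a0; clear - a1; lra.
Qed.

(** * From edge sets to the laws of random graphs *)

Lemma sum_sgraph (R : realType) (n : nat) (F : {set {set 'I_n}} -> R) :
  \sum_(G : sgraph n) F (val G) = \sum_(G | is_graph G) F G.
Proof.
symmetry; rewrite (reindex_omap (val : sgraph n -> _) insub) /=; last first.
  by move=> G gG; rewrite insubT.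
by apply: eq_bigl => G; rewrite valK eqxx andbT; exact: (valP G).
Qed.

Lemma degree_vdeg (n : nat) (G : sgraph n) (i : 'I_n) :
  degree G i = vdeg (val G) i.
Proof. by apply: eq_card => e; rewrite !inE. Qed.

Lemma has_degrees_mem (n : nat) (dd : 'I_n -> nat) (G : sgraph n) :
  has_degrees dd G = (val G \in graphs_with dd).
Proof.
rewrite inE (valP G : is_graph (val G)) /=.
by apply: eq_forallb => i; rewrite degree_vdeg.
Qed.

Lemma realisable_graphs_with (n : nat) (dd : 'I_n -> nat) :
  realisable dd -> (0 < #|graphs_with dd|)%N.
Proof.
by move=> [G]; rewrite has_degrees_mem => GG; apply/card_gt0P; exists (val G).
Qed.

Lemma gnp_law_thin (R : realType) (n : nat) (p : R) (G : sgraph n) :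
  gnp_law p G = thin [set pairs 'I_n] #|pairs 'I_n| p (val G).
Proof.
have GE : val G \subset pairs 'I_n.
  by apply/subsetP => e eG; rewrite inE; exact: (forall_inP (valP G)).
rewrite /thin; have -> : supersets [set pairs 'I_n] (val G) = [set pairs 'I_n].
  by apply/setP => H; rewrite !inE; case: eqP => //= ->.
rewrite cards1 divff ?oner_eq0 // mulr1 -prod_subset_const //.
by apply: eq_bigl => e; rewrite inE.
Qed.

Lemma gnd_law_uniform (R : realType) (n : nat) (dd : 'I_n -> nat) (G : sgraph n) :
  gnd_law R dd G = (val G \in graphs_with dd)%:R / #|graphs_with dd|%:R.
Proof.
rewrite /gnd_law has_degrees_mem; case: ifP => _; last by rewrite mul0r.
rewrite mul1r; congr (_%:R^-1).
rewrite -(card_imset _ val_inj); apply: eq_card => H; apply/imsetP/idP.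
  by move=> [K KH ->]; rewrite -has_degrees_mem; exact: KH.
move=> HG; have gH := graphs_with_graph HG.
exists (Sub H gH : sgraph n); last by rewrite SubK.
by rewrite inE has_degrees_mem SubK.
Qed.

Lemma coupling_of_embeds (R : realType) (n : nat) (dd : 'I_n -> nat) (p x : R) :
    0 <= p <= 1 -> realisable dd ->
    embeds (thin [set pairs 'I_n] #|pairs 'I_n| p)
      (fun G => (G \in graphs_with dd)%:R / #|graphs_with dd|%:R) x ->
  exists kappa : sgraph n * sgraph n -> R,
    is_coupling (gnp_law p) (gnd_law R dd) kappa /\
    1 - x <= prob kappa (fun GG => edges GG.1 \subset edges GG.2) <= 1.
Proof.
move=> p01 /realisable_graphs_with GG0 [k [[k0 k1 k2] sup mk]].
pose k' (G H : sgraph n) := k (val G) (val H).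
have off1 X : ~~ is_graph X -> forall Y, k X Y = 0.
  move=> nX Y; apply/eqP; rewrite eq_le k0 andbT.
  have [l _] := subcoupling_le X Y (And3 k0 k1 k2).
  apply: le_trans l _; rewrite /thin.
  have -> : supersets [set pairs 'I_n] X = finset.set0.
    apply/setP => H; rewrite !inE; case: eqP => //= ->; apply: contraNF nX => XE.
    by apply/forall_inP => e /(subsetP XE); rewrite inE.
  by rewrite cards0 mul0r mulr0.
have off2 Y : ~~ is_graph Y -> forall X, k X Y = 0.
  move=> nY X; apply/eqP; rewrite eq_le k0 andbT.
  have [_ l] := subcoupling_le X Y (And3 k0 k1 k2).
  apply: le_trans l _; rewrite inE (negbTE nY) /= mul0r //.
have sum1 G : \sum_H k' G H = \sum_Y k (val G) Y.
  rewrite (sum_sgraph (k (val G))) [RHS](bigID (@is_graph _)) /=.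
  by rewrite [X in _ + X]big1 ?addr0 // => Y nY; apply: off2.
have sum2 H : \sum_G k' G H = \sum_X k X (val H).
  rewrite (sum_sgraph (fun X => k X (val H))) [RHS](bigID (@is_graph _)) /=.
  by rewrite [X in _ + X]big1 ?addr0 // => Y nY; apply: off1.
have mu1 : \sum_(G : sgraph n) gnp_law p G = 1.
  under eq_bigr => G _ do rewrite gnp_law_thin.
  rewrite (sum_sgraph (thin [set pairs 'I_n] #|pairs 'I_n| p)).
  have szF (F : {set {set 'I_n}}) : F \in [set pairs 'I_n] -> #|F| = #|pairs 'I_n|.
    by rewrite inE => /eqP ->.
  have F0 : (0 < #|[set pairs 'I_n]|)%N by rewrite cards1.
  rewrite -[RHS](thin_sum1 p szF F0).
  rewrite [RHS](bigID (@is_graph _)) /= [X in _ + X]big1 ?addr0 // => X nX.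
  rewrite /thin; have -> : supersets [set pairs 'I_n] X = finset.set0.
    apply/setP => H; rewrite !inE; case: eqP => //= ->; apply: contraNF nX => XE.
    by apply/forall_inP => e /(subsetP XE); rewrite inE.
  by rewrite cards0 mul0r mulr0.
have nu1 : \sum_(G : sgraph n) gnd_law R dd G = 1.
  under eq_bigr => G _ do rewrite gnd_law_uniform.
  rewrite -mulr_suml -natr_sum.
  rewrite (_ : (\sum_(G : sgraph n) (val G \in graphs_with dd))%N%:R = #|graphs_with dd|%:R :> R).
    by rewrite divff // pnatr_eq0 -lt0n.
  rewrite natr_sum (sum_sgraph (fun G => (G \in graphs_with dd)%:R)) -sum1_card natr_sum.
  rewrite big_mkcond [RHS]big_mkcond /=; apply: eq_bigr => G _.
  by rewrite inE; case: (is_graph G) => //=; case: ifP.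
have sk : subcoupling (gnp_law p) (gnd_law R dd) k'.
  split; first by move=> G H; apply: k0.
    by move=> G; rewrite sum1 gnp_law_thin.
  by move=> H; rewrite sum2 gnd_law_uniform.
have [kappa [kk m1 m2]] := subcoupling_extend mu1 nu1 sk.
have kp0 q : 0 <= kappa q by apply: le_trans (kk q); apply: k0.
have tot : \sum_q kappa q = 1.
  rewrite -mu1; under [RHS]eq_bigr => G _ do rewrite -m1.
  by rewrite pair_bigA /=; apply: eq_bigr => -[].
exists kappa; split; first by split.
apply/andP; split.
  apply: le_trans mk _; rewrite /mass (bigID (@is_graph _)) /=.
  rewrite [X in _ + X]big1 ?addr0; last first.
    by move=> X nX; rewrite big1 // => Y _; apply: off1.
  rewrite -(sum_sgraph (fun X => \sum_Y k X Y)).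
  under eq_bigr => G _ do rewrite -sum1.
  rewrite pair_bigA /= /prob [X in _ <= X]big_mkcond /=.
  apply: ler_sum => -[G H] _ /=; case: ifPn => GH; first exact: kk (G, H).
  have [->//|/sup] := eqVneq (k' G H) 0; by rewrite (negbTE GH).
rewrite -tot /prob [X in X <= _]big_mkcond /=; apply: ler_sum => q _.
by case: ifP.
Qed.

(** * Asymptotics *)

Local Open Scope classical_set_scope.
Local Open Scope ring_scope.

Lemma mindeg_le (n : nat) (dd : 'I_n -> nat) (i : 'I_n) : (mindeg dd <= dd i)%N.
Proof.
rewrite /mindeg; have : i \in index_enum 'I_n by apply: mem_index_enum.
elim: (index_enum _) => [//|j r IH]; rewrite inE big_cons => /orP[/eqP <-|/IH H].
  exact: geq_minl.
exact: leq_trans (geq_minr _ _) H.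
Qed.

Lemma littleo_eventually (R : realType) (f g : nat -> R) :
  ((f : nat -> R^o) =o_\oo (g : nat -> R^o)) -> forall e : R, 0 < e ->
  exists N, forall n, (N <= n)%N -> `|f n| <= e * `|g n|.
Proof.
move=> /eqoP H e e0; have [N _ HN] := H e e0.
by exists N => n Nn; apply: HN.
Qed.

(** The pair w consists of the relative error of the density and the coupling;
    the precision is 1 / (k + 1). *)
Definition approx_sandwich (R : realType) (n : nat) (d : R) (dd : 'I_n -> nat)
    (k : nat) (w : R * (sgraph n * sgraph n -> R)) : Prop :=
  let p := (1 - w.1) * (d / n%:R) in
  [/\ `|w.1| <= k.+1%:R^-1, 0 <= p <= 1,
      is_coupling (@gnp_law R n p) (@gnd_law R n dd) w.2
    & 1 - k.+1%:R^-1
        <= prob w.2 (fun GG => edges GG.1 \subset edges GG.2) <= 1].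

Lemma natr_ge_eventually (R : realType) (x : R) :
  exists N, forall n, (N <= n)%N -> x <= n%:R.
Proof.
exists (Num.truncn x).+1 => n Nn; apply: ltW.
by apply: lt_le_trans (truncnS_gt x) _; rewrite ler_nat.
Qed.

Lemma near_regular_bounds (R : realType) (d : nat -> R)
    (dd : forall n : nat, 'I_n -> nat) (e : R) :
    (forall n : nat, (0 < n)%N -> 0 < d n) ->
    ((d : nat -> R^o) =o_\oo (fun n : nat => n%:R : R^o)) ->
    near_regular d dd -> 0 < e ->
  exists N, forall n, (N <= n)%N -> forall i : 'I_n,
    (1 - e) * d n <= (dd n i)%:R <= (1 + e) * d n.
Proof.
move=> d_gt0 d_ll_n [Hmax Hrng] e0.
have e2 : 0 < e / 2 by rewrite divr_gt0.
have [N1 H1] := littleo_eventually Hmax e2.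
have [N2 H2] := littleo_eventually Hrng e2.
have [N3 H3] := littleo_eventually d_ll_n (@ltr01 R).
exists (maxn (maxn N1 N2) (maxn N3 1)) => n; rewrite !geq_max.
move=> /andP[/andP[/H1 h1 /H2 h2] /andP[/H3 h3 n0]] i.
have d0 := d_gt0 n n0.
have dn : d n <= n%:R.
  by move: h3; rewrite mul1r !ger0_norm // ltW.
have m0 : `|Num.min (d n) (n%:R - d n)| <= d n.
  rewrite ger0_norm ?ge_min ?lexx // le_min (ltW d0) subr_ge0 dn //.
have a1 : `|(maxdeg (dd n))%:R - d n| <= e / 2 * d n.
  rewrite normr_id in h1.
  by apply: le_trans h1 _; rewrite ler_wpM2l // ltW.
have a2 : (rng (dd n))%:R <= e / 2 * d n.
  apply: le_trans (_ : `|(rng (dd n))%:R : R| <= _); first exact: ler_norm.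
  by apply: le_trans h2 _; rewrite ler_wpM2l // ltW.
have up : (dd n i)%:R <= (maxdeg (dd n))%:R :> R.
  by rewrite ler_nat /maxdeg; exact: (leq_bigmax i).
have low : (maxdeg (dd n))%:R <= (dd n i)%:R + (rng (dd n))%:R :> R.
  by rewrite -natrD ler_nat /rng -leq_subLR leq_sub2l // mindeg_le.
move: a1; rewrite ler_distl => /andP[a3 a4].
by apply/andP; split; clear - a2 a3 a4 up low; lra.
Qed.

Lemma eventually_approx (R : realType) (d : nat -> R)
    (dd : forall n : nat, 'I_n -> nat) (k : nat) :
    (forall n : nat, (0 < n)%N -> 0 < d n) ->
    ((fun n : nat => ln n%:R : R^o) =o_\oo (d : nat -> R^o)) ->
    ((d : nat -> R^o) =o_\oo (fun n : nat => n%:R : R^o)) ->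
    near_regular d dd -> (forall n : nat, realisable (dd n)) ->
  exists N, forall n, (N <= n)%N -> exists w, approx_sandwich (d n) (dd n) k w.
Proof.
move=> d_gt0 ln_ll_d d_ll_n dd_near dd_real.
have k0 : 1 <= k.+1%:R :> R by rewrite ler1n.
pose a : R := 1 / 100 / k.+1%:R.
have a0 : 0 < a by rewrite !divr_gt0 // (lt_le_trans ltr01).
have a1 : a <= 1 / 100 by rewrite ler_pdivrMr ?ler_peMr // (lt_le_trans ltr01).
have ak : 100 * a = k.+1%:R^-1 by rewrite /a; field; rewrite gt_eqF // (lt_le_trans ltr01).
have a01 : 0 < a <= 1 / 100 by rewrite a0.
have a30 : 0 < a ^+ 3 by rewrite exprn_gt0.
have a40 : 0 < a ^+ 4 by rewrite exprn_gt0.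
have a38 : 0 < a ^+ 3 / 8 by rewrite divr_gt0.
have [N1 H1] := littleo_eventually ln_ll_d a38.
have e0 : 0 < expR (- (80 / a ^+ 3)) / 8 by rewrite divr_gt0 // expR_gt0.
have [N2 H2] := littleo_eventually d_ll_n e0.
have [N3 H3] := near_regular_bounds d_gt0 d_ll_n dd_near a0.
have [N4 H4] := natr_ge_eventually (20 / a ^+ 4).
have [N5 H5] := natr_ge_eventually (expR 1 : R).
exists (maxn (maxn (maxn N1 N2) (maxn N3 N4)) (maxn N5 1)) => n.
rewrite !geq_max => /andP[/andP[/andP[/H1 h1 /H2 h2] /andP[/H3 h3 /H4 h4]] /andP[/H5 h5 n0]].
have d0 := d_gt0 n n0.
have nr0 : 0 < n%:R :> R by rewrite ltr0n.
have ln1 : 1 <= ln n%:R :> R.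
  by rewrite -[X in X <= _]expRK ler_ln ?posrE ?expR_gt0.
have {}h1 : 8 / a ^+ 3 * ln n%:R <= d n.
  move: h1; rewrite !ger0_norm ?(ltW d0) ?(le_trans ler01) // => h1.
  have c0 : 0 <= 8 / a ^+ 3 by rewrite divr_ge0 // ltW.
  apply: le_trans (ler_wpM2l c0 h1) _.
  by rewrite mulrA (_ : 8 / a ^+ 3 * (a ^+ 3 / 8) = 1) ?mul1r //; field; rewrite gt_eqF.
have h0 : 8 / a ^+ 3 <= d n.
  apply: le_trans h1; rewrite ler_peMr // divr_ge0 // ltW //.
have {}h2 : 8 * d n / n%:R <= expR (- (80 / a ^+ 3)).
  move: h2; rewrite !ger0_norm ?(ltW d0) // => h2.
  by rewrite ler_pdivrMr //; clear - h2; lra.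
have {}h4 : 20 <= a ^+ 4 * n%:R by rewrite mulrC -ler_pdivrMr.
have cn : #|'I_n| = n by rewrite card_ord.
have V0 : (0 < #|'I_n|)%N by rewrite cn.
have := @finite_embedding R 'I_n (dd n) a (d n) a01 V0
  (realisable_graphs_with (dd_real n)).
rewrite cn => /(_ h0 h1 h2 h4 h3) [p [/andP[p1 p2] p01 emb]].
have [kappa [cpl pr]] := coupling_of_embeds p01 (dd_real n) emb.
have t0 : 0 < d n / n%:R by rewrite divr_gt0.
pose e := 1 - p / (d n / n%:R).
have pE : (1 - e) * (d n / n%:R) = p by rewrite /e subKr divfK ?gt_eqF.
have e_ge : 0 <= e by rewrite subr_ge0 ler_pdivrMr // mul1r.
have e_le : e <= 20 * a.
  by rewrite /e lerBlDr addrC -lerBlDr ler_pdivlMr.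
exists (e, kappa); rewrite /approx_sandwich /= pE; split=> //.
  by rewrite ger0_norm // -ak; clear - e_le a0; lra.
by have /andP[q1 ->] := pr; rewrite andbT -ak; clear - q1 a0; lra.
Qed.

Lemma trivial_approx (R : realType) (n : nat) (d : R) (dd : 'I_n -> nat) :
  realisable dd -> exists w, approx_sandwich d dd 0 w.
Proof.
move=> Hr; have p01 : 0 <= (0 : R) <= 1 by rewrite lexx ler01.
have emb : embeds (thin [set pairs 'I_n] #|pairs 'I_n| (0 : R))
      (fun G => (G \in graphs_with dd)%:R / #|graphs_with dd|%:R) 1.
  exists (fun _ _ => 0); split.
  - split=> [//|U|S]; first by rewrite big1 ?thin_ge0.
    by rewrite big1 ?divr_ge0.
  - by move=> U S; rewrite eqxx.
  - by rewrite subrr /mass big1 // => U _; rewrite big1.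
have [kappa [cpl pr]] := coupling_of_embeds p01 Hr emb.
exists (1, kappa); rewrite /approx_sandwich /= subrr mul0r; split=> //.
  by rewrite invr1 normr1.
by rewrite invr1.
Qed.

Lemma cvg_of_inverse_bound (R : realType) (u : nat -> R) (l : R) (kk : nat -> nat) :
    (forall k, exists N, forall n, (N <= n)%N -> (k <= kk n)%N) ->
    (forall n, `|u n - l| <= (kk n).+1%:R^-1) ->
  u @ \oo --> l.
Proof.
move=> Hk Hu; apply/cvgrPdist_le => e e0.
have [k Hke] := natr_ge_eventually (e^-1).
have [N HN] := Hk k; exists N => // n /= Nn.
rewrite distrC; apply: le_trans (Hu n) _.
rewrite -[e]invrK lef_pV2 ?posrE ?invr_gt0 //.
apply: le_trans (Hke k (leqnn _)) _; rewrite ler_nat.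
exact: leq_trans (HN n Nn) (leqnSn _).
Qed.

Theorem theorem1p7 (R : realType) (d : nat -> R)
    (dd : forall n : nat, 'I_n -> nat)
    (d_gt0 : forall n : nat, (0 < n)%N -> 0 < d n)
    (ln_ll_d : (fun n : nat => ln n%:R : R^o) =o_\oo (d : nat -> R^o))
    (d_ll_n : (d : nat -> R^o) =o_\oo (fun n : nat => n%:R : R^o))
    (dd_lt : forall (n : nat) (i : 'I_n), (dd n i < n)%N)
    (dd_near : near_regular d dd)
    (dd_real : forall n : nat, realisable (dd n)) :
  exists (p eps : nat -> R)
         (kappa : forall n : nat, sgraph n * sgraph n -> R),
    [/\ eps @ \oo --> (0 : R),
        forall n : nat, p n = (1 - eps n) * (d n / n%:R),
        forall n : nat, 0 <= p n <= 1,
        forall n : nat,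
          is_coupling (@gnp_law R n (p n)) (@gnd_law R n (dd n)) (kappa n)
      & (fun n : nat =>
           prob (kappa n) (fun GG => edges GG.1 \subset edges GG.2)) @ \oo
          --> (1 : R)].
Proof.
(* At n use the best precision attained, at most n: every fixed precision is
   attained for large n, so the best one tends to infinity. *)
pose Q n k := (k <= n)%N && `[< exists w, approx_sandwich (d n) (dd n) k w >].
have Q0 n : exists k, Q n k.
  by exists 0%N; rewrite /Q leq0n; apply/asboolP; apply: trivial_approx.
have Qle n k : Q n k -> (k <= n)%N by case/andP.
pose kk n := ex_maxn (Q0 n) (Qle n).
have Hkk n : exists w, approx_sandwich (d n) (dd n) (kk n) w.
  by rewrite /kk; case: ex_maxnP => k /andP[_ /asboolP].
have kk_inf k : exists N, forall n, (N <= n)%N -> (k <= kk n)%N.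
  have [N HN] := eventually_approx k d_gt0 ln_ll_d d_ll_n dd_near dd_real.
  exists (maxn N k) => n; rewrite geq_max => /andP[Nn kn].
  rewrite /kk; case: ex_maxnP => j _; apply.
  by rewrite /Q kn; apply/asboolP; apply: HN.
pose w n := projT1 (cid (Hkk n)).
have Hw n : approx_sandwich (d n) (dd n) (kk n) (w n) by exact: (projT2 (cid (Hkk n))).
exists (fun n => (1 - (w n).1) * (d n / n%:R)), (fun n => (w n).1), (fun n => (w n).2).
split.
- apply: (cvg_of_inverse_bound kk_inf) => n; rewrite subr0.
  by have [] := Hw n.
- by [].
- by move=> n; have [] := Hw n.
- by move=> n; have [] := Hw n.
- apply: (cvg_of_inverse_bound kk_inf) => n.
  have [_ _ _ /andP[q1 q2]] := Hw n.
  by rewrite distrC ger0_norm ?subr_ge0 // lerBlDr addrC -lerBlDr.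
Qed.
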